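(* With $O(n)$ preprocessing, unweighted sorted-no-self-APSD enumeration can be solved with delay in $O(\Delta)$, using $\Theta(n^2)$ lazy-initialized memory and with space complexity in $\Theta(n^2)$.
   Context: Input: a directed or undirected unweighted graph $G=(V,E)$, $V=\{1,\dots,n\}$. $\Delta$ is the maximum (out-)degree. $d(u,v)$ is the hop distance ($\infty$ if unreachable). Sorted-no-self-APSD enumeration: output each triple $(u,v,d(u,v))$ with $u\neq v$ exactly once, in nondecreasing order of $d(u,v)$. Preprocessing: time before enumeration starts; delay in $O(f)$: time to first output after preprocessing, between consecutive outputs, and to signal termination are each $O(f)$. Model: word RAM, word size $\Omega(\log n)$, read-only adjacency lists with constant-time degree access. Lazy-initialized memory: allocatable in constant time without initialization, with constant-time detection of unwritten cells. *)

(* Defs.v *)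
From mathcomp Require Import all_boot.

Set Implicit Arguments.
Unset Strict Implicit.
Unset Printing Implicit Defensive.

(** * Graphs

    A graph on the vertex set V = 'I_n is an edge relation [e]; an undirected
    graph is the special case of a symmetric [e], each edge then being listed
    at both of its ends.  Self-loops are allowed. *)

Definition max_degree n (e : rel 'I_n) : nat :=
  \max_(u < n) #|[pred v | e u v]|.

Definition adjacency_lists n (e : rel 'I_n) (adj : 'I_n -> seq 'I_n) : Prop :=
  forall u, uniq (adj u) /\ forall v, (v \in adj u) = e u v.

Definition walk n (e : rel 'I_n) (u v : 'I_n) (p : seq 'I_n) : bool :=
  path e u p && (last u p == v).

(** [hop_dist e u v d] says d(u,v) = d, with [None] for infinity. *)
Definition hop_dist n (e : rel 'I_n) (u v : 'I_n) (d : option nat) : Prop :=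
  match d with
  | Some k => (exists2 p, walk e u v p & size p = k) /\
              (forall p, walk e u v p -> k <= size p)
  | None => forall p, ~~ walk e u v p
  end.

Definition le_dist (a b : option nat) : bool :=
  match a, b with
  | _, None => true
  | None, Some _ => false
  | Some x, Some y => x <= y
  end.

Definition sorted_no_self_APSD n (e : rel 'I_n)
    (out : seq ('I_n * 'I_n * option nat)) : Prop :=
  [/\ uniq out,
      forall u v d, (u, v, d) \in out <-> u <> v /\ hop_dist e u v d
    & sorted (fun x y => le_dist x.2 y.2) out].

(** * Word RAM

    Words are naturals below 2 ^ w.  A program is a finite list of
    instructions, each costing one time unit; it works on
    - registers, of which a program mentions only a fixed finite number;
    - ordinary memory, whose initial contents are arbitrary;
    - lazy-initialized memory, obtained by [ILAlloc];
    - the read-only input graph, given by [INumV], [IDeg] and [IAdj].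
    Vertices are represented by the words 0, ..., n-1. *)

Inductive binop := OpAdd | OpSub | OpMul | OpDiv | OpMod | OpLt | OpEq.

Inductive instr :=
  | IConst (r c : nat)
  | IOp (o : binop) (r a b : nat)
  | ILoad (r a : nat)             (* r := mem[a] *)
  | IStore (a r : nat)            (* mem[a] := r *)
  | ILAlloc (r s : nat)           (* r := address of s fresh lazy cells *)
  | ILWritten (r a : nat)         (* r := has lazy[a] been written? *)
  | ILLoad (r a : nat)            (* r := lazy[a] *)
  | ILStore (a r : nat)           (* lazy[a] := r *)
  | INumV (r : nat)               (* r := n *)
  | IDeg (r u : nat)              (* r := out-degree of vertex u *)
  | IAdj (r u i : nat)            (* r := i-th out-neighbour of vertex u *)
  | IJmp (l : nat)
  | IJz (r l : nat)               (* jump to l if r = 0 *)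
  | IReady                        (* end of preprocessing *)
  | IOutput (u v d : nat)         (* output (u, v, d) *)
  | IOutputInf (u v : nat)        (* output (u, v, infinity) *)
  | IHalt.

Definition program := seq instr.

Inductive event :=
  | Ready
  | Output (u v : nat) (d : option nat)
  | Halted.

Record state := State {
  pc : nat;
  reg : nat -> nat;
  mem : nat -> nat;
  mem_used : nat;              (* 1 + largest ordinary address accessed *)
  lazy : nat -> option nat;    (* [None]: never written *)
  lazy_size : nat              (* number of lazy cells allocated *)
}.

Definition init (mem0 : nat -> nat) : state :=
  State 0 (fun _ => 0) mem0 0 (fun _ => None) 0.

Definition upd T (f : nat -> T) (a : nat) (x : T) : nat -> T :=
  fun b => if b == a then x else f b.

Definition eval_binop (w : nat) (o : binop) (x y : nat) : nat :=
  match o with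
  | OpAdd => x + y
  | OpSub => x + 2 ^ w - y
  | OpMul => x * y
  | OpDiv => x %/ y
  | OpMod => x %% y
  | OpLt => x < y
  | OpEq => x == y
  end.

Definition advance (s : state) : state :=
  State (pc s).+1 (reg s) (mem s) (mem_used s) (lazy s) (lazy_size s).

Definition goto (l : nat) (s : state) : state :=
  State l (reg s) (mem s) (mem_used s) (lazy s) (lazy_size s).

(** The reduction modulo 2 ^ w here makes all arithmetic modular. *)
Definition set_reg (w r x : nat) (s : state) : state :=
  State (pc s) (upd (reg s) r (x %% 2 ^ w)) (mem s) (mem_used s)
        (lazy s) (lazy_size s).

Definition touch (a : nat) (s : state) : state :=
  State (pc s) (reg s) (mem s) (maxn (mem_used s) a.+1) (lazy s) (lazy_size s).

Definition set_mem (a x : nat) (s : state) : state :=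
  State (pc s) (reg s) (upd (mem s) a x) (mem_used s) (lazy s) (lazy_size s).

Definition set_lazy (a x : nat) (s : state) : state :=
  State (pc s) (reg s) (mem s) (mem_used s) (upd (lazy s) a (Some x))
        (lazy_size s).

Definition grow_lazy (k : nat) (s : state) : state :=
  State (pc s) (reg s) (mem s) (mem_used s) (lazy s) (lazy_size s + k).

(** One step of instruction [i]; [None] means that the machine is stuck:
    access outside the input or outside allocated lazy memory, read of an
    unwritten lazy cell, allocation beyond the address space.  [IHalt] is
    treated in [run]. *)
Definition step (w n : nat) (adj : 'I_n -> seq 'I_n) (i : instr) (s : state) :
    option (state * option event) :=
  let R := reg s in
  let set r x s' := Some (advance (set_reg w r x s'), None) in
  match i with
  | IConst r c => set r c s
  | IOp o r a b => set r (eval_binop w o (R a) (R b)) s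
  | ILoad r a => set r (mem s (R a)) (touch (R a) s)
  | IStore a r => Some (advance (set_mem (R a) (R r) (touch (R a) s)), None)
  | ILAlloc r k =>
      if lazy_size s + R k <= 2 ^ w
      then set r (lazy_size s) (grow_lazy (R k) s) else None
  | ILWritten r a =>
      if R a < lazy_size s then set r (isSome (lazy s (R a))) s else None
  | ILLoad r a =>
      if R a < lazy_size s then
        if lazy s (R a) is Some x then set r x s else None
      else None
  | ILStore a r =>
      if R a < lazy_size s
      then Some (advance (set_lazy (R a) (R r) s), None) else None
  | INumV r => set r n s
  | IDeg r u =>
      if insub (R u) is Some x then set r (size (adj x)) s else None
  | IAdj r u k =>
      if insub (R u) is Some x then
        if R k < size (adj x)
        then set r (nth 0 (map val (adj x)) (R k)) s else None
      else None
  | IJmp l => Some (goto l s, None)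
  | IJz r l => Some (if R r == 0 then goto l s else advance s, None)
  | IReady => Some (advance s, Some Ready)
  | IOutput u v d => Some (advance s, Some (Output (R u) (R v) (Some (R d))))
  | IOutputInf u v => Some (advance s, Some (Output (R u) (R v) None))
  | IHalt => None
  end.

(** [run w adj P t s tr sf]: started at time [t] in state [s], program [P]
    halts in state [sf], having produced the time-stamped events [tr]. *)
Inductive run (w n : nat) (adj : 'I_n -> seq 'I_n) (P : program) :
    nat -> state -> seq (nat * event) -> state -> Prop :=
  | run_halt t s :
      onth P (pc s) = Some IHalt -> run w adj P t s [:: (t.+1, Halted)] s
  | run_silent t s i s' tr sf :
      onth P (pc s) = Some i -> step w adj i s = Some (s', None) ->
      run w adj P t.+1 s' tr sf -> run w adj P t s tr sf
  | run_event t s i s' ev tr sf :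
      onth P (pc s) = Some i -> step w adj i s = Some (s', Some ev) ->
      run w adj P t.+1 s' tr sf -> run w adj P t s ((t.+1, ev) :: tr) sf.

(** Space in words.  The input and the output do not count; the registers
    contribute a constant depending on the program only. *)
Definition space (sf : state) : nat := mem_used sf + lazy_size sf.

(** * Bounds with hidden constant [c]

    The [maxn 1] only matters for degenerate parameters (g = 0), where no
    running time can be bounded by [c * g]. *)

Definition in_O (c f g : nat) : bool := f <= c * maxn 1 g.

Definition in_Theta (c f g : nat) : bool := (g <= c * f) && in_O c f g.

(** The run consists of preprocessing, then the outputs [out] in this order,
    then termination. *)
Definition trace_of n (tr : seq (nat * event))
    (out : seq ('I_n * 'I_n * option nat)) : Prop :=
  unzip2 tr =
    Ready :: rcons [seq Output x.1.1 x.1.2 x.2 | x : 'I_n * 'I_n * option nat <- out] Halted.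

Definition preprocessing_in_O (c f : nat) (tr : seq (nat * event)) : bool :=
  in_O c (head 0 (unzip1 tr)) f.

(** The gaps are those from [Ready] to the first output, between consecutive
    outputs, and from the last output to [Halted]. *)
Definition delay_in_O (c f : nat) (tr : seq (nat * event)) : bool :=
  sorted (fun t t' => in_O c (t' - t) f) (unzip1 tr).

(* Main.v *)
Require Import Defs.
From mathcomp Require Import all_boot zify.

Set Implicit Arguments.
Unset Strict Implicit.
Unset Printing Implicit Defensive.

(** Idea.  All pairs (u, v) are kept in one permutation of the n^2 pair codes
    (with its inverse), stored lazily and split into three zones:

      [0, lo)      found pairs, in order of discovery: the BFS queue L;
      [lo, hi)     pairs not found yet;
      [hi, n^2)    pairs found, but never to be dequeued: H.

    Finding a pair swaps it to a boundary of the middle zone, in O(1).  When the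
    search is over, the middle zone is exactly the set of unreachable pairs,
    which can thus be listed without gaps.

    A multi-source BFS that outputs (u, v, d) when it dequeues it and then
    expands it has delay O(Delta), but for the pairs (u, u), whose expansion
    outputs nothing.  Preprocessing therefore enqueues only those (u, u) for
    which u has a neighbour other than itself.  Dequeuing such a pair first
    moves all (u, v) with u -> v to H, and then outputs and expands each of
    them at once, so every O(Delta) steps there is at least one output.  After
    that the queue contains precisely the pairs at distance two. *)

(** * Structured programs *)

Inductive cmd :=
  | Skip
  | Basic (i : instr)
  | Seq (c1 c2 : cmd)
  | If (r : nat) (c1 c2 : cmd)
  | While (a b : nat) (c : cmd).   (* while reg a < reg b; clobbers reg 0 *)

Notation "c1 ;; c2" := (Seq c1 c2) (at level 61, right associativity).

Fixpoint csize (c : cmd) : nat :=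
  match c with
  | Skip => 0
  | Basic _ => 1
  | Seq c1 c2 => csize c1 + csize c2
  | If _ c1 c2 => (csize c1 + (csize c2).+1).+1
  | While _ _ c => (csize c + 1).+2
  end.

Fixpoint comp (b : nat) (c : cmd) : program :=
  match c with
  | Skip => [::]
  | Basic i => [:: i]
  | Seq c1 c2 => comp b c1 ++ comp (b + csize c1) c2
  | If r c1 c2 =>
      IJz r (b.+1 + csize c1).+1 ::
      comp b.+1 c1 ++
      IJmp ((b.+1 + csize c1).+1 + csize c2) ::
      comp (b.+1 + csize c1).+1 c2
  | While r1 r2 c =>
      IOp OpLt 0 r1 r2 :: IJz 0 (b.+2 + csize c + 1) ::
      comp b.+2 c ++ [:: IJmp b]
  end.

Lemma size_comp c b : size (comp b c) = csize c.
Proof.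
elim: c b => //= [c1 IH1 c2 IH2|r c1 IH1 c2 IH2|r1 r2 c IH] b;
  by rewrite ?size_cat /= ?IH1 ?IH2 ?IH.
Qed.

Definition code_at (P : program) b (c : program) : Prop :=
  exists p q, P = p ++ c ++ q /\ size p = b.

Lemma code_at_cat P b c1 c2 :
  code_at P b (c1 ++ c2) -> code_at P b c1 /\ code_at P (b + size c1) c2.
Proof.
move=> [p [q [-> <-]]]; split; first by exists p, (c2 ++ q); rewrite -catA.
by exists (p ++ c1), q; rewrite size_cat -!catA.
Qed.

Lemma code_at_cons P b i c :
  code_at P b (i :: c) -> onth P b = Some i /\ code_at P b.+1 c.
Proof.
move=> [p [q [-> <-]]]; split; first by rewrite onth_cat ltnn subnn.
by exists (rcons p i), q; rewrite cat_rcons size_rcons.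
Qed.

(** * Configurations with their past trace, and frame conditions *)

Record cfg := Cfg { clk : nat; st : state; trc : seq (nat * event) }.

Notation R x := (reg (st x)).
Notation Z x := (lazy (st x)).
Notation zsize x := (lazy_size (st x)).

(** Frame condition of a silent stretch of code: [W] are the registers it may change, [k] bounds its
    time, and [z] is the resulting lazy memory. It neither emits events nor touches ordinary
    memory. *)
Record eff (W : seq nat) (k : nat) (z : nat -> option nat) (x y : cfg) : Prop :=
  Eff {
  eff_reg : forall r, r \notin W -> R y r = R x r;
  eff_lazy : Z y = z;
  eff_size : zsize y = zsize x;
  eff_mem : mem_used (st y) = mem_used (st x);
  eff_trc : trc y = trc x;
  eff_clk : clk y <= clk x + k }.

Lemma eff_refl W k x : eff W k (Z x) x x.
Proof. by split=> //; apply: leq_addr. Qed.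

Lemma eff_trans W1 W2 k1 k2 z1 z2 x1 x2 x3 :
  eff W1 k1 z1 x1 x2 -> eff W2 k2 z2 x2 x3 ->
  eff (W1 ++ W2) (k1 + k2) z2 x1 x3.
Proof.
move=> [r1 l1 s1 m1 t1 c1] [r2 l2 s2 m2 t2 c2]; split;
  rewrite -?l1 -?s1 -?m1 -?t1 //; last lia.
by move=> r; rewrite mem_cat negb_or => /andP[/r1 <- /r2].
Qed.

Lemma eff_weaken W1 W2 k1 k2 z1 z2 x y :
  eff W1 k1 z1 x y -> all (mem W2) W1 -> k1 <= k2 -> z1 = z2 ->
  eff W2 k2 z2 x y.
Proof.
move=> [r1 l1 s1 m1 t1 c1] /allP sub le <-; split=> //; last lia.
by move=> r nr; apply: r1; apply: contra nr; apply: sub.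
Qed.

Record emit (ev : event) (x y : cfg) : Prop := Emit {
  em_reg : forall r, R y r = R x r;
  em_lazy : Z y = Z x;
  em_size : zsize y = zsize x;
  em_mem : mem_used (st y) = mem_used (st x);
  em_clk : clk y = (clk x).+1;
  em_trc : trc y = rcons (trc x) (clk y, ev) }.

Ltac regs := repeat match goal with
  | H : reg (st ?y) ?r = _ |- context [reg (st ?y) ?r] => rewrite H
  | H : eff _ _ _ _ ?y |- context [reg (st ?y) ?r] =>
      rewrite (eff_reg H (r := r) isT)
  | H : emit _ _ ?y |- context [reg (st ?y) ?r] => rewrite (em_reg H r)
  | H : emit _ _ ?y |- context [lazy (st ?y)] => rewrite (em_lazy H)
  | H : emit _ _ ?y |- context [lazy_size (st ?y)] => rewrite (em_size H)
  | H : eff _ _ _ _ ?y |- context [lazy (st ?y)] => rewrite (eff_lazy H)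
  | H : eff _ _ _ _ ?y |- context [lazy_size (st ?y)] => rewrite (eff_size H)
  | H : eff _ _ _ _ ?y |- context [trc ?y] => rewrite (eff_trc H)
  end.

Ltac chain := eapply eff_weaken;
  [ repeat first [ eassumption | eapply eff_trans; [eassumption |] ]
  | by []
  | lia
  | by regs ].

(** * Weakest preconditions for structured programs and single instructions *)

Section Machine.

Context {w n : nat} {adj : 'I_n -> seq 'I_n}.

Definition completes P (x : cfg) T sf : Prop :=
  exists2 tr, T = trc x ++ tr & run w adj P (clk x) (st x) tr sf.

(** Reachability is phrased backwards, through runs that halt, because [run] has no notion of a
    partial execution. Composing [leads] up to a halting configuration yields an actual [run]. *)
Definition leads P x y : Prop :=
  forall T sf, completes P y T sf -> completes P x T sf.

Definition tick (x : cfg) (s : state) (ev : option event) : cfg :=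
  Cfg (clk x).+1 s
      (if ev is Some a then rcons (trc x) ((clk x).+1, a) else trc x).

Lemma leads_step P x i s ev :
  onth P (pc (st x)) = Some i -> step w adj i (st x) = Some (s, ev) ->
  leads P x (tick x s ev).
Proof.
move=> Pi si T sf [tr -> r]; case: ev si r => [a|] si r /=.
  by exists (((clk x).+1, a) :: tr);
    [rewrite cat_rcons | apply: run_event Pi si r].
by exists tr => //; apply: run_silent Pi si r.
Qed.

(** Total correctness: some configuration satisfying [Q] is reached just behind the code of [c].
    Quantifying over [P] and [b] makes the rules independent of where the code is placed, although
    jump targets are absolute. *)
Definition wp (c : cmd) (Q : cfg -> Prop) (x : cfg) : Prop :=
  forall P b, code_at P b (comp b c) -> pc (st x) = b ->
  exists y, [/\ leads P x y, pc (st y) = b + csize c & Q y].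

Lemma wp_mono c Q Q' x : (forall y, Q y -> Q' y) -> wp c Q x -> wp c Q' x.
Proof. by move=> QQ wc P b cP px; have [y [? ? /QQ]] := wc P b cP px;
  exists y. Qed.

Lemma wp_skip Q x : Q x -> wp Skip Q x.
Proof. by move=> Qx P b _ <-; exists x; rewrite addn0; split=> // T sf. Qed.

Lemma wp_seq c1 c2 Q x : wp c1 (wp c2 Q) x -> wp (c1 ;; c2) Q x.
Proof.
move=> w1 P b /code_at_cat[c1P]; rewrite size_comp => c2P px.
have [y [xy py w2]] := w1 P b c1P px.
have [z [yz pz Qz]] := w2 P _ c2P py.
by exists z; rewrite /= addnA; split=> // T sf /yz /xy.
Qed.

Lemma wp_step i s ev Q x :
  step w adj i (st x) = Some (s, ev) -> pc s = (pc (st x)).+1 ->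
  Q (tick x s ev) -> wp (Basic i) Q x.
Proof.
move=> si ps Qy P b /code_at_cons[Pi _] px.
exists (tick x s ev); split=> //=; last by rewrite ps px addn1.
by apply: leads_step si; rewrite px.
Qed.

(** The extra [eff [::] 1] behind [c1] is the jump over the else branch, which only the first branch
    pays for. *)
Lemma wp_if r c1 c2 Q x :
  (forall y, eff [::] 1 (Z x) x y -> R x r != 0 ->
     wp c1 (fun y' => forall z, eff [::] 1 (Z y') y' z -> Q z) y) ->
  (forall y, eff [::] 1 (Z x) x y -> R x r = 0 -> wp c2 Q y) ->
  wp (If r c1 c2) Q x.
Proof.
move=> w1 w2 P b /code_at_cons[Pi /code_at_cat[P1]].
rewrite size_comp => /code_at_cons[Pj P2] px.
pose s := if R x r == 0 then goto (b.+1 + csize c1).+1 (st x)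
          else advance (st x).
have xy : leads P x (tick x s None) by apply: leads_step; rewrite ?px ?Pi.
have e : eff [::] 1 (Z x) x (tick x s None).
  by split; rewrite /= /s ?addn1 //; case: ifP.
rewrite /s in xy e; case: ifP xy e => [/eqP r0|/negbT r0] xy e.
  have [z [yz pz Qz]] := w2 _ e r0 P _ P2 erefl.
  by exists z; split=> //; [move=> T sf /yz /xy | rewrite pz /=; lia].
have [z [yz pz Qz]] := w1 _ e r0 P _ P1 (congr1 S px).
exists (tick z (goto ((b.+1 + csize c1).+1 + csize c2) (st z)) None).
split; [| by rewrite /=; lia | by apply: Qz; split; rewrite //= ?addn1].
move=> T sf full; apply/xy/yz; move: T sf full.
by apply: leads_step; rewrite ?pz ?Pj.
Qed.

Lemma bool_lt_exp (u : bool) : 0 < w -> u < 2 ^ w.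
Proof. by have := ltn_expl w (isT : 1 < 2); case: u; lia. Qed.

(** The invariant is indexed by the iteration count, which [K] bounds, whence termination. A test
    costs two steps (comparison and branch), the jump back one. *)
Lemma wp_while a b c (I : nat -> cfg -> Prop) K i x Q :
  I i x ->
  (forall i x, I i x -> R x a < R x b -> i < K /\
     forall y, eff [:: 0] 2 (Z x) x y ->
     wp c (fun y' => forall z, eff [::] 1 (Z y') y' z -> I i.+1 z) y) ->
  (forall i x y, I i x -> R x b <= R x a -> eff [:: 0] 2 (Z x) x y -> Q y) ->
  0 < w -> wp (While a b c) Q x.
Proof.
(* Induction on the number of iterations left; the successor leaves room for the final failing test
   at [i = K]. *)
move=> Ix body exit w0 P l cP; have [m im] := ubnP (K.+1 - i).
elim: m => // m IHm in i x Ix im * => px.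
have /code_at_cons[Po /code_at_cons[Pz /code_at_cat[Pc]]] := cP.
rewrite size_comp => /code_at_cons[Pj _].
pose s := advance (set_reg w 0 (R x a < R x b) (st x)).
pose s' := if (R x a < R x b) then advance s else goto (l.+2 + csize c + 1) s.
have bit (u : bool) : u %% 2 ^ w = u.
  by rewrite modn_small // bool_lt_exp.
have xy : leads P x (tick (tick x s None) s' None).
  move=> T sf full.
  apply: (leads_step (i := IOp OpLt 0 a b) (s := s) (ev := None)) => //.
    by rewrite px.
  apply: (leads_step (i := IJz 0 (l.+2 + csize c + 1)) (s := s')
    (ev := None)) => //.
    by rewrite /= px.
  by rewrite /= /upd /= bit /s' eqb0; case: (R x a < R x b).
have e : eff [:: 0] 2 (Z x) x (tick (tick x s None) s' None).
  split; rewrite /= /s' ?addn2 //; case: ifP => //= _ r;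
    by rewrite inE /upd => /negPf ->.
rewrite /s' in xy e; case: ltnP xy e => [lt|ge] xy e; last first.
  exists (tick (tick x s None) (goto (l.+2 + csize c + 1) s) None).
  by split=> //=; [lia | apply: exit Ix ge e].
have [iK /(_ _ e) wb] := body _ _ Ix lt.
have [|y [yz py Iy]] := wb P l.+2 Pc; first by rewrite /= px.
pose y' := tick y (goto l (st y)) None.
have yy' : leads P y y' by apply: leads_step; rewrite ?py ?Pj.
have Iy' : I i.+1 y' by apply: Iy; split; rewrite //= ?addn1.
have [|z [yz' pz Qz]] := IHm _ _ Iy' _ erefl; first lia.
by exists z; split=> // T sf /yz' /yy' /yz /xy.
Qed.

Lemma wp_setr i r v x Q :
  step w adj i (st x) = Some (advance (set_reg w r v (st x)), None) ->
  v < 2 ^ w ->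
  (forall y, eff [:: r] 1 (Z x) x y -> R y r = v -> Q y) ->
  wp (Basic i) Q x.
Proof.
move=> si lt HQ; apply: wp_step si _ _ => //; apply: HQ.
  split; rewrite //= ?addn1 // => r'.
  by rewrite inE /upd => /negPf ->.
by rewrite /= /upd eqxx modn_small.
Qed.

Lemma wp_const r c x Q :
  c < 2 ^ w ->
  (forall y, eff [:: r] 1 (Z x) x y -> R y r = c -> Q y) ->
  wp (Basic (IConst r c)) Q x.
Proof. by apply: wp_setr. Qed.

Lemma wp_add r a b v x Q :
  R x a + R x b = v -> v < 2 ^ w ->
  (forall y, eff [:: r] 1 (Z x) x y -> R y r = v -> Q y) ->
  wp (Basic (IOp OpAdd r a b)) Q x.
Proof. by move=> <-; apply: wp_setr. Qed.

Lemma wp_mul r a b v x Q :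
  R x a * R x b = v -> v < 2 ^ w ->
  (forall y, eff [:: r] 1 (Z x) x y -> R y r = v -> Q y) ->
  wp (Basic (IOp OpMul r a b)) Q x.
Proof. by move=> <-; apply: wp_setr. Qed.

Lemma wp_div r a b v x Q :
  R x a %/ R x b = v -> v < 2 ^ w ->
  (forall y, eff [:: r] 1 (Z x) x y -> R y r = v -> Q y) ->
  wp (Basic (IOp OpDiv r a b)) Q x.
Proof. by move=> <-; apply: wp_setr. Qed.

Lemma wp_mod r a b v x Q :
  R x a %% R x b = v -> v < 2 ^ w ->
  (forall y, eff [:: r] 1 (Z x) x y -> R y r = v -> Q y) ->
  wp (Basic (IOp OpMod r a b)) Q x.
Proof. by move=> <-; apply: wp_setr. Qed.

(** Stating the difference as a sum excludes a borrow, so that the modular result is the true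
    one. *)
Lemma wp_sub r a b v x Q :
  R x b + v = R x a -> R x a < 2 ^ w ->
  (forall y, eff [:: r] 1 (Z x) x y -> R y r = v -> Q y) ->
  wp (Basic (IOp OpSub r a b)) Q x.
Proof.
move=> e lt HQ; have lt' : v < 2 ^ w by lia.
apply: wp_step => //=; apply: HQ.
  split; rewrite //= ?addn1 // => r'.
  by rewrite inE /upd => /negPf ->.
rewrite /= /upd eqxx -e.
have -> : R x b + v + 2 ^ w - R x b = v + 2 ^ w by lia.
by rewrite modnDr modn_small.
Qed.

Lemma wp_lt r a b x Q : 0 < w ->
  (forall y, eff [:: r] 1 (Z x) x y -> R y r = (R x a < R x b) -> Q y) ->
  wp (Basic (IOp OpLt r a b)) Q x.
Proof.
by move=> w0; apply: wp_setr => //=; apply: bool_lt_exp.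
Qed.

Lemma wp_eq r a b x Q : 0 < w ->
  (forall y, eff [:: r] 1 (Z x) x y -> R y r = (R x a == R x b) -> Q y) ->
  wp (Basic (IOp OpEq r a b)) Q x.
Proof.
by move=> w0; apply: wp_setr => //=; apply: bool_lt_exp.
Qed.

Lemma wp_numv r x Q :
  n < 2 ^ w ->
  (forall y, eff [:: r] 1 (Z x) x y -> R y r = n -> Q y) ->
  wp (Basic (INumV r)) Q x.
Proof. by apply: wp_setr. Qed.

Lemma wp_deg r a (u : 'I_n) x Q :
  R x a = u -> size (adj u) < 2 ^ w ->
  (forall y, eff [:: r] 1 (Z x) x y -> R y r = size (adj u) -> Q y) ->
  wp (Basic (IDeg r a)) Q x.
Proof. by move=> e; apply: wp_setr; rewrite /= e valK. Qed.

Lemma wp_adj r a k (u v : 'I_n) x Q :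
  R x a = u -> R x k < size (adj u) -> nth v (adj u) (R x k) = v ->
  n < 2 ^ w ->
  (forall y, eff [:: r] 1 (Z x) x y -> R y r = v -> Q y) ->
  wp (Basic (IAdj r a k)) Q x.
Proof.
move=> e lt ev n2; apply: wp_setr; last exact: ltn_trans n2.
by rewrite /= e valK lt (nth_map v) // ev.
Qed.

Lemma wp_lwritten r a x Q : 0 < w -> R x a < zsize x ->
  (forall y, eff [:: r] 1 (Z x) x y -> R y r = isSome (Z x (R x a)) -> Q y) ->
  wp (Basic (ILWritten r a)) Q x.
Proof.
move=> w0 lt; apply: wp_setr; first by rewrite /= lt.
exact: bool_lt_exp.
Qed.

Lemma wp_lload r a v x Q :
  R x a < zsize x -> Z x (R x a) = Some v -> v < 2 ^ w ->
  (forall y, eff [:: r] 1 (Z x) x y -> R y r = v -> Q y) ->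
  wp (Basic (ILLoad r a)) Q x.
Proof. by move=> lt e; apply: wp_setr; rewrite /= lt e. Qed.

Lemma wp_lstore a r x Q :
  R x a < zsize x ->
  (forall y, eff [::] 1 (upd (Z x) (R x a) (Some (R x r))) x y -> Q y) ->
  wp (Basic (ILStore a r)) Q x.
Proof.
move=> lt HQ; apply: wp_step; first by rewrite /= lt.
  by [].
by apply: HQ; split; rewrite //= ?addn1.
Qed.

(** As [eff] fixes the size of the lazy memory, the frame condition starts from the configuration
    with the memory already grown. *)
Lemma wp_alloc r a x Q :
  zsize x + R x a <= 2 ^ w -> zsize x < 2 ^ w ->
  (forall y, eff [:: r] 1 (Z x) (Cfg (clk x) (grow_lazy (R x a) (st x))
    (trc x)) y ->
     R y r = zsize x -> Q y) ->
  wp (Basic (ILAlloc r a)) Q x.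
Proof.
move=> le lt HQ; apply: wp_step; [by rewrite /= le | by [] | apply: HQ].
  split; rewrite //= ?addn1 // => r'.
  by rewrite inE /upd => /negPf ->.
by rewrite /= /upd eqxx modn_small.
Qed.

Lemma wp_emit i ev x Q :
  step w adj i (st x) = Some (advance (st x), Some ev) ->
  (forall y, emit ev x y -> Q y) -> wp (Basic i) Q x.
Proof. by move=> si HQ; apply: wp_step si _ _ => //; apply: HQ; split. Qed.

End Machine.

(** * Hop distances and breadth-first search *)

Section Distance.

Variables (n : nat) (e : rel 'I_n).
Implicit Types (u v x : 'I_n) (p : 'I_n * 'I_n).

(** A decidable form of: distance at most [k]. Walks are extended at their far end, just as the
    search expands a pair. *)
Fixpoint near k p : bool :=
  if k is k'.+1 then near k' p || [exists x, near k' (p.1, x) && e x p.2]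
  else p.1 == p.2.

Lemma near_le j k p : j <= k -> near j p -> near k p.
Proof.
move=> /subnK <-; elim: (k - j) => // m IH /IH.
by rewrite addSn /= => ->.
Qed.

Lemma near_edge k u x v : near k (u, x) -> e x v -> near k.+1 (u, v).
Proof. by move=> ux xv /=; apply/orP; right; apply/existsP; exists x;
  rewrite ux. Qed.

Lemma near1 p : near 1 p = (p.1 == p.2) || e p.1 p.2.
Proof.
case: p => u v /=; congr (_ || _); apply/existsP/idP => [[x /andP[/eqP<-]] //|uv].
by exists u; rewrite eqxx.
Qed.

Lemma nearP k u v :
  reflect (exists2 q, walk e u v q & size q <= k) (near k (u, v)).
Proof.
apply: (iffP idP).
  elim: k v => [|k IH] v /=; first by move/eqP=> <-; exists [::];
    rewrite /walk ?eqxx.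
  case/orP=> [/IH[q ? le]|/existsP[x /andP[/IH[q /andP[pq /eqP lq] le] xv]]].
    by exists q => //; apply: leqW.
  exists (rcons q v); last by rewrite size_rcons.
  by rewrite /walk rcons_path last_rcons eqxx pq lq xv.
case=> q; elim/last_ind: q k v => [|q x IH] k v.
  by move=> /andP[_ /= uv] _; apply: near_le (leq0n k) _; rewrite /= uv.
rewrite /walk rcons_path last_rcons => /andP[/andP[pq ex] /eqP xv].
rewrite size_rcons; case: k => // k lt; apply: (near_edge (x := last u q));
  last by rewrite -xv.
by apply: IH; rewrite // /walk pq eqxx.
Qed.

Lemma hop_dist_near k u v :
  near k.+1 (u, v) -> ~~ near k (u, v) -> hop_dist e u v (Some k.+1).
Proof.
move=> /nearP[q wq leq] far.
have low r : walk e u v r -> k < size r.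
  by move=> wr; rewrite ltnNge; apply: contra far => le; apply/nearP; exists r.
by split=> //; exists q => //; apply/eqP; rewrite eqn_leq leq low.
Qed.

Lemma hop_dist_uniq u v d1 d2 :
  hop_dist e u v d1 -> hop_dist e u v d2 -> d1 = d2.
Proof.
case: d1 d2 => [a|] [b|] //=.
- move=> [[p wp <-] lp] [[q wq <-] lq].
  by congr Some; apply/eqP; rewrite eqn_leq lp ?lq.
- by move=> [[p wp _] _] /(_ p); rewrite wp.
- by move=> no [[p wp _] _]; have := no p; rewrite wp.
Qed.

(* State of the search while distance [d] is being expanded: [vis] are the
   pairs found so far, [C] the pairs at distance [d] still to be expanded, and
   [E] the pairs found at distance [d.+1]. *)
Record frontier d (vis C E : pred ('I_n * 'I_n)) : Prop := Frontier {
  fr_vis : forall p, vis p = near d p || E p;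
  fr_next : forall p, E p -> near d.+1 p && ~~ near d p;
  fr_cur : forall p, C p -> near d p && ~~ near d.-1 p;
  fr_closed : forall u x v, near d (u, x) -> ~~ C (u, x) -> e x v -> vis (u, v)
}.

Lemma frontier_eq d (vis vis' C C' E E' : pred ('I_n * 'I_n)) :
  frontier d vis C E -> vis =1 vis' -> C =1 C' -> E =1 E' ->
  frontier d vis' C' E'.
Proof.
move=> [fv fn fc cl] ev eC eE; split.
- by move=> p; rewrite -ev -eE.
- by move=> p; rewrite -eE => /fn.
- by move=> p; rewrite -eC => /fc.
- by move=> u x v ux; rewrite -eC -ev; apply: cl.
Qed.

(** [X] are the pairs found by expanding (u, v). Each extends a pair at distance at most [d] by one
    edge, and is not itself that near, since [vis] contains the whole ball of radius [d]. *)
Lemma frontier_expand d (vis vis' C C' E E' X : pred ('I_n * 'I_n)) u v :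
  frontier d vis C E -> near d (u, v) ->
  (forall p, C p -> p = (u, v) \/ C' p) -> (forall p, C' p -> C p) ->
  (forall p, vis' p = vis p || X p) -> (forall p, E' p = E p || X p) ->
  (forall p, X p -> [/\ ~~ vis p, p.1 = u & e v p.2]) ->
  (forall x, e v x -> vis' (u, x)) ->
  frontier d vis' C' E'.
Proof.
move=> [fv fn fc cl] uv CC' C'C vis'E E'E XP all; split.
- by move=> p; rewrite vis'E E'E fv orbA.
- move=> p; rewrite E'E => /orP[/fn //|/XP[nv pu pv]].
  have := nv; rewrite fv negb_or => /andP[-> _]; rewrite andbT.
  by case: p pu pv {nv} => a b /= -> pv; apply: near_edge uv pv.
- by move=> p /C'C /fc.
- move=> a x b ax nC xb; case: (boolP (C (a, x))) => [/CC'[[-> xv]|C'x]|nCx].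
  + by apply: all; rewrite -xv.
  + by rewrite C'x in nC.
  + by rewrite vis'E (cl _ _ _ ax nCx xb).
Qed.

(** Once nothing of the current level is left, closure puts every pair of the next ball into [vis];
    so [vis] is that ball and [E] its outer sphere. *)
Lemma frontier_level d vis C E :
  frontier d vis C E -> C =1 xpred0 -> frontier d.+1 vis E xpred0.
Proof.
move=> [fv fn fc cl] C0.
have near_vis p : near d.+1 p = vis p.
  apply/idP/idP; last by rewrite fv => /orP[/(near_le (leqnSn d)) //|/fn/andP[]].
  case: p => u v /= /orP[|/existsP[x /andP[ux xv]]]; first by rewrite fv => ->.
  by apply: cl ux _ xv; rewrite C0.
split=> //.
- by move=> p; rewrite orbF near_vis.
- move=> u x v ux nE xv; rewrite -near_vis; apply: near_edge xv.
  by move: ux; rewrite near_vis fv (negPf nE) orbF.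
Qed.

(** With both levels empty, [vis] is a ball closed under edges, so by induction on the length it
    catches the end of every walk. *)
Lemma frontier_end d vis C E u v :
  frontier d vis C E -> C =1 xpred0 -> E =1 xpred0 -> ~~ vis (u, v) ->
  hop_dist e u v None.
Proof.
move=> [fv _ _ cl] C0 E0 nvis q; apply: contra nvis => wq.
have {wq} : near (size q) (u, v) by apply/nearP; exists q.
have visE p : vis p = near d p by rewrite fv E0 orbF.
rewrite visE; elim: (size q) v => [|k IH] v; first by apply: near_le.
move=> /= /orP[/IH //|/existsP[x /andP[/IH ux xv]]].
by rewrite -visE; apply: cl ux _ xv; rewrite C0.
Qed.

(* State of the search at distance one: [M] are the sources whose neighbours
   have been marked, [B] the edges u -> v for which (u, v) has been expanded. *)
Record stage1 (M : pred 'I_n) (B : rel 'I_n)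
  (vis E : pred ('I_n * 'I_n)) : Prop :=
  Stage1 {
  s1_vis : forall p, vis p = [|| p.1 == p.2, E p | M p.1 && e p.1 p.2];
  s1_next : forall p, E p -> near 2 p && ~~ near 1 p;
  s1_closed : forall u v x, B u v -> e v x -> vis (u, x) }.

(** Marked pairs join [vis] but not [E]: they are edges, so they do not belong to the level at
    distance two. *)
Lemma stage1_mark (M M' : pred 'I_n) B (vis vis' E X : pred ('I_n * 'I_n)) u :
  stage1 M B vis E -> (forall a, M' a = M a || (a == u)) ->
  (forall p, vis' p = vis p || X p) -> (forall p, X p -> p.1 = u /\ e p.1 p.2) ->
  (forall x, e u x -> vis' (u, x)) -> stage1 M' B vis' E.
Proof.
move=> [sv sn sc] MM vX XP all; split=> //; last first.
  by move=> a v x Bav vx; rewrite vX (sc _ _ _ Bav vx).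
move=> p; rewrite MM; apply/idP/idP.
  rewrite vX sv => /orP[/or3P[->|->|/andP[-> ->]]|/XP[-> ->]];
    rewrite ?eqxx ?orbT //.
case: p => a b /= /or3P[ab|Eab|/andP[/orP[Ma|/eqP ->] ab]]; last exact: all.
- by rewrite vX sv /= ab.
- by rewrite vX sv Eab orbT.
- by rewrite vX sv /= Ma ab !orbT.
Qed.

(** As [u] is marked, [vis] already holds all pairs from [u] at distance at most one. An unvisited
    pair reached along u -> v -> x is therefore at distance exactly two, which is why marking must
    precede expansion. *)
Lemma stage1_expand M (B B' : rel 'I_n)
  (vis vis' E E' X : pred ('I_n * 'I_n)) u v :
  stage1 M B vis E -> M u -> e u v ->
  (forall a b, B' a b -> B a b \/ (a = u /\ b = v)) ->
  (forall p, vis' p = vis p || X p) -> (forall p, E' p = E p || X p) ->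
  (forall p, X p -> [/\ ~~ vis p, p.1 = u & e v p.2]) ->
  (forall x, e v x -> vis' (u, x)) -> stage1 M B' vis' E'.
Proof.
move=> [sv sn sc] Mu uv BB vX EX XP all; split=> //.
- by move=> p; rewrite vX EX sv; case: (_ == _); case: (E p); case: (X p);
  rewrite ?orbT ?orbF.
- move=> p; rewrite EX => /orP[/sn //|/XP[nv pu vp]].
  have : ~~ near 1 p.
    by move: nv; rewrite sv near1 !negb_or pu Mu => /and3P[-> _ ->].
  move=> ->; rewrite andbT; case: p pu vp {nv} => a b;
    rewrite [(a, b).1]/= [(a, b).2]/= => -> vb.
  by apply: (near_edge (k := 1) _ vb); rewrite near1 /= uv orbT.
- move=> a b x /BB[Bab|[-> ->]] bx; last exact: all.
  by rewrite vX (sc _ _ _ Bab bx).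
Qed.

Lemma stage1_sub (M M' : pred 'I_n) (B B' : rel 'I_n) vis E :
  stage1 M B vis E -> M =1 M' -> (forall a b, B' a b -> B a b) ->
  stage1 M' B' vis E.
Proof.
move=> [sv sn sc] MM BB; split=> //; first by move=> p; rewrite -MM.
by move=> u v x /BB; apply: sc.
Qed.

(** Self-loops need no expansion: the successors of (u, u) are the neighbours of [u], which marking
    has covered. *)
Lemma stage1_end M B vis E :
  stage1 M B vis E -> (forall u v, e u v -> u != v -> M u && B u v) ->
  frontier 1 vis xpred0 E.
Proof.
move=> [sv sn sc] full.
have visE p : vis p = near 1 p || E p.
  rewrite sv near1 -orbA; case: eqP => //= ne; rewrite orbC; congr (_ || _).
  case ep : (e _ _); rewrite ?andbF // andbT.
  by have /andP[] := full _ _ ep (introN eqP ne).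
split=> // u x v; rewrite near1 /= => /orP[/eqP <-|ux] _ xv.
  by rewrite visE near1 /= xv orbT.
case: (eqVneq u x) => [ex|ne]; first by rewrite visE near1 /= ex xv orbT.
by have /andP[_ Bux] := full _ _ ux ne; apply: sc Bux xv.
Qed.

End Distance.

(** * The partition of the pairs *)

Section SparseSet.

Variable n : nat.
Notation N := (n * n).
Notation vpair := ('I_n * 'I_n)%type.
Implicit Types (z : nat -> option nat) (p q : vpair) (L H : seq vpair).

Definition code (p : vpair) : nat := p.1 * n + p.2.

Lemma code_lt p : code p < N.
Proof.
case: p => u v; rewrite /code /=; have := leq_mul (ltn_ord u) (leqnn n).
by have := ltn_ord v; rewrite mulSn; lia.
Qed.

Lemma code_div p : code p %/ n = p.1.
Proof.
have n0 : 0 < n by case: p => u _; case: u => m; lia.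
by rewrite /code divnMDl // divn_small ?addn0.
Qed.

Lemma code_mod p : code p %% n = p.2.
Proof. by rewrite /code modnMDl modn_small. Qed.

Lemma code_inj : injective code.
Proof.
move=> p q pq; have := code_div p; have := code_mod p.
rewrite pq code_div code_mod; case: p q {pq} => [a b] [c d] /= h1 h2.
by congr pair; apply: val_inj.
Qed.

Lemma code_onto i : i < N -> exists p, i = code p.
Proof.
move=> lt; have n0 : 0 < n by case: (n) lt => //; rewrite muln0.
have d : i %/ n < n by rewrite ltn_divLR.
have m : i %% n < n by rewrite ltn_mod.
by exists (Ordinal d, Ordinal m); rewrite /code /= -divn_eq.
Qed.

(* Cells [0, N) of the lazy memory hold a permutation of the pair codes and
   cells [N, 2 N) its inverse; a cell never written stands for a fixed point. *)
Definition prm z i : nat := odflt i (z i).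
Definition pos z i : nat := odflt i (z (N + i)).

(** Exchange in the permutation: code [i] goes to position [j], and the former occupant of [j] to
    the old position of [i]; the inverse is updated alongside. *)
Definition moved z j i : nat -> option nat :=
  upd (upd (upd (upd z (pos z i) (Some (prm z j)))
                (N + prm z j) (Some (pos z i)))
           j (Some i))
      (N + i) (Some j).

(** The low zone spells out [L] in order, since it serves as a queue; of [H] only the set of members
    matters. *)
Record zones z L H : Prop := Zones {
  zn_prm : forall i, i < N -> prm z i < N /\ pos z (prm z i) = i;
  zn_pos : forall i, i < N -> pos z i < N /\ prm z (pos z i) = i;
  zn_size : size L + size H <= N;
  zn_low : forall i, i < size L -> prm z i = nth 0 (map code L) i;
  zn_high : forall p, (p \in H) = (N - size H <= pos z (code p)) }.

(** Untouched memory represents the identity permutation, so the quadratic structure costs no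
    initialization time. *)
Lemma zones_init z : (forall a, z a = None) -> zones z [::] [::].
Proof.
move=> z0; split; rewrite /prm /pos //=.
- by move=> i; rewrite !z0.
- by move=> i; rewrite !z0.
move=> p; rewrite z0 /=; by rewrite in_nil subn0 /= leqNgt code_lt.
Qed.

Lemma zn_mem_low z L H p : zones z L H -> (p \in L) = (pos z (code p) < size L).
Proof.
move=> [zp zq zs zl zh]; apply/idP/idP => [pL|lt].
  have lt : index p L < size L by rewrite index_mem.
  have := zl _ lt; rewrite (nth_map p) // nth_index // => <-.
  by rewrite (zp (index p L) _).2 //; lia.
have [_] := zq _ (code_lt p); rewrite zl // (nth_map p) //.
by move/code_inj=> <-; apply: mem_nth.
Qed.

(** This is the constant-time test for a pair not found yet: one look at the inverse and two
    comparisons. *)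
Lemma zn_free z L H p : zones z L H ->
  (p \notin L ++ H) = (size L <= pos z (code p) < N - size H).
Proof.
by move=> zn; rewrite mem_cat (zn_mem_low p zn)
  (zn_high zn) negb_or -leqNgt -ltnNge.
Qed.

Lemma zn_uniq z L H : zones z L H -> uniq L.
Proof.
move=> zn; rewrite -(map_inj_uniq code_inj); apply/(uniqP 0) => i j.
rewrite !inE !size_map => /= iL jL ij.
have zs := zn_size zn.
have iN : i < N by lia.
have jN : j < N by lia.
by rewrite -((zn_prm zn iN).2) -((zn_prm zn jN).2) !(zn_low zn) // ij.
Qed.

Lemma zn_disjoint z L H p : zones z L H -> p \in L -> p \in H -> False.
Proof.
move=> zn; rewrite (zn_mem_low p zn) (zn_high zn); have := zn_size zn; lia.
Qed.

Lemma zn_get z L H i p0 : zones z L H -> i < size L ->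
  prm z i = code (nth p0 L i).
Proof. by move=> zn lt; rewrite (zn_low zn) // (nth_map p0). Qed.

Lemma prm_moved z j i a :
  a < N -> prm (moved z j i) a =
  if a == j then i else if a == pos z i then prm z j else prm z a.
Proof.
move=> aN; rewrite /prm /moved /upd.
have neq m : (a == N + m) = false by apply/eqP; lia.
by rewrite !neq; case: ifP => // _; case: ifP.
Qed.

Lemma pos_moved z j i a : j < N -> pos z i < N ->
  pos (moved z j i) a =
  if a == i then j else if a == prm z j then pos z i else pos z a.
Proof.
move=> jN iN; rewrite {1}/pos /moved /upd !eqn_add2l.
have -> : (N + a == j) = false by apply/eqP; lia.
have -> : (N + a == pos z i) = false by apply/eqP; lia.
by case: ifP => // _; case: ifP.
Qed.

(** An exchange keeps the two maps mutually inverse. The cases ask whether [a] is one of the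
    exchanged entries; collisions contradict the old inverse laws. *)
Lemma moved_prm_pos z L H j i : zones z L H -> j < N -> i < N ->
  (forall a, a < N ->
     prm (moved z j i) a < N /\ pos (moved z j i) (prm (moved z j i) a) = a) /\
  (forall a, a < N ->
     pos (moved z j i) a < N /\ prm (moved z j i) (pos (moved z j i) a) = a).
Proof.
move=> [zp zq _ _ _] jN iN; have [iP iQ] := zq _ iN; have [jP jQ] := zp _ jN.
split=> a aN; have [aP aQ] := zp _ aN; have [aP' aQ'] := zq _ aN.
- rewrite prm_moved // pos_moved //; split; first by do 2?case: ifP.
  case: (a =P j) => [->|aj]; first by rewrite eqxx.
  case: (a =P pos z i) => [ai|ai].
    by rewrite eqxx; case: eqP => // ji; move: ai; rewrite -ji jQ => /esym.
  case: eqP => [ei|_]; first by case: ai; rewrite -ei aQ.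
  by case: eqP => // ej; case: aj; rewrite -aQ ej jQ.
- rewrite pos_moved // prm_moved; last by do 2?case: ifP.
  split; first by do 2?case: ifP.
  case: (a =P i) => [->|ai]; first by rewrite eqxx.
  case: (a =P prm z j) => [aj|aj].
    rewrite eqxx; case: eqP => // ij; case: ai; by rewrite aj -ij iQ.
  case: eqP => [ej|_]; first by case: aj; rewrite -ej aQ'.
  by case: eqP => // ei; case: ai; rewrite -aQ' ei iQ.
Qed.

(** Both exchanged positions lie in the middle zone, whose first position is [size L]; the outer
    zones are untouched and the low one then grows by that position. *)
Lemma zones_push_low z L H p : zones z L H -> p \notin L ++ H ->
  zones (moved z (size L) (code p)) (rcons L p) H.
Proof.
move=> zn free; have := free; rewrite (zn_free p zn) => /andP[lo hi].
have [iN _] := zn_pos zn (code_lt p).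
have LN : size L < N by lia.
have [mp mq] := moved_prm_pos zn LN (code_lt p).
split=> //; first by rewrite size_rcons; lia.
  move=> i; rewrite size_rcons ltnS map_rcons nth_rcons size_map => iL.
  rewrite prm_moved; last lia.
  case: (i =P size L) => [->|ne]; first by rewrite ltnn.
  have lt : i < size L by lia.
  rewrite lt -(zn_low zn) //; case: eqP => // ei; lia.
move=> q; rewrite (zn_high zn) pos_moved //.
have zs := zn_size zn.
case: (code q =P code p) => [->|_]; first by apply/idP/idP; lia.
case: eqP => // eq; rewrite eq (zn_prm zn LN).2; apply/idP/idP; lia.
Qed.

Lemma zones_push_high z L H p : zones z L H -> p \notin L ++ H ->
  zones (moved z (N - size H).-1 (code p)) L (p :: H).
Proof.
move=> zn free; have := free; rewrite (zn_free p zn) => /andP[lo hi].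
have [iN ip] := zn_pos zn (code_lt p).
have jN : (N - size H).-1 < N by lia.
have [mp mq] := moved_prm_pos zn jN (code_lt p).
split=> //; first by rewrite /=; lia.
  move=> i iL; rewrite -(zn_low zn) // prm_moved; last lia.
  by case: eqP => [|_]; [lia|case: eqP => // ?; lia].
move=> q; rewrite inE (zn_high zn) pos_moved //= -(inj_eq code_inj).
case: (code q =P code p) => [->|ne] /=; first by apply/esym/idP; lia.
case: eqP => [eq|nq].
  rewrite eq (zn_prm zn jN).2.
  (* Here [q] is the displaced pair. It lands at the old position of [p], which is not the last of
     the middle zone because [q] differs from [p]; so [q] stays out of the high zone. *)
  have pj : pos z (code p) <> (N - size H).-1 by move=> pj; case: ne;
    rewrite eq -pj.
  by apply/idP/idP; lia.
have [qN qp] := zn_pos zn (code_lt q).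
case: (pos z (code q) =P (N - size H).-1) => [eq|]; last by move=> *;
  apply/idP/idP; lia.
by case: nq; rewrite -eq.
Qed.

(** For listing the unreachable pairs: the first entry of the middle zone joins the low zone by
    moving the boundary alone, without any write. *)
Lemma zones_free z L H : zones z L H -> size L + size H < N ->
  exists p, [/\ prm z (size L) = code p, p \notin L ++ H & zones z (rcons L p) H].
Proof.
move=> zn lt; have LN : size L < N by lia.
have [pN pp] := zn_prm zn LN; have [p pE] := code_onto pN.
exists p; have nfree : p \notin L ++ H by rewrite (zn_free p zn) -pE pp; lia.
split=> //; case: zn => zp zq zs zl zh; split=> //; first by rewrite size_rcons;
  lia.
move=> i; rewrite size_rcons ltnS map_rcons nth_rcons size_map.
by case: ltngtP => // [/zl //|-> _].
Qed.

End SparseSet.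

(** * Building blocks of the program *)

(* Registers 0-9 are scratch; 10, ..., 14 hold n, n^2, 1 and the bounds lo, hi
   of the middle zone; 15 and 16 hold the current u and v. *)

(** Register [d] holds the value of an unwritten cell. Multiplying by register 12, which holds one,
    is how registers are copied throughout. *)
Definition lookup r a d :=
  Basic (ILWritten 1 a) ;;
  If 1 (Basic (ILLoad r a)) (Basic (IOp OpMul r d 12)).

(** Realizes [moved] for the position in register [j] and the code in register 7. *)
Definition move_to j :=
  lookup 2 j j ;; Basic (IOp OpAdd 3 11 7) ;; lookup 4 3 7 ;;
  Basic (ILStore 4 2) ;; Basic (IOp OpAdd 5 11 2) ;; Basic (ILStore 5 4) ;;
  Basic (ILStore j 7) ;; Basic (ILStore 3 j).

Definition push (low : bool) :=
  if low then move_to 13 ;; Basic (IOp OpAdd 13 13 12)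
  else Basic (IOp OpSub 14 14 12) ;; move_to 14.

Definition push_if_free (low : bool) :=
  Basic (IOp OpAdd 3 11 7) ;; lookup 4 3 7 ;;
  Basic (IOp OpLt 5 4 13) ;;
  If 5 Skip (Basic (IOp OpLt 5 4 14) ;; If 5 (push low) Skip).

Definition push_nbrs (low : bool) :=
  Basic (IConst 8 0) ;; Basic (IDeg 9 16) ;;
  While 8 9
    (Basic (IAdj 6 16 8) ;; Basic (IOp OpMul 7 15 10) ;;
     Basic (IOp OpAdd 7 7 6) ;; push_if_free low ;;
     Basic (IOp OpAdd 8 8 12)).

(** * Invariant of the data structure *)

Section Invariant.

Variable n : nat.
Notation N := (n * n).
Implicit Types L H : seq ('I_n * 'I_n).

Record inv L H (x : cfg) : Prop := Inv {
  inv_n : R x 10 = n;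
  inv_N : R x 11 = N;
  inv_1 : R x 12 = 1;
  inv_lo : R x 13 = size L;
  inv_hi : R x 14 = N - size H;
  inv_size : zsize x = N + N;
  inv_mem : mem_used (st x) = 0;
  inv_zn : zones (Z x) L H }.

Lemma inv_eff W k z L H x y :
  inv L H x -> eff W k z x y -> z = Z x -> all (fun r =>
    r \notin W) (iota 10 5) ->
  inv L H y.
Proof.
move=> [i1 i2 i3 i4 i5 i6 i7 i8] [er el es em et ec] ez /and5P[w0 w1 w2 w3
  /andP[w4 _]].
by split; rewrite ?er ?es ?em ?el ?ez.
Qed.

Lemma inv_emit L H ev x y : inv L H x -> emit ev x y -> inv L H y.
Proof. by move=> [? ? ? ? ? ? ? ?] E; split;
  rewrite ?(em_reg E) ?(em_size E) ?(em_mem E) ?(em_lazy E). Qed.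

End Invariant.

Ltac keep I := eapply (inv_eff I);
  [ repeat first [ eassumption | eapply eff_trans; [eassumption |] ]
  | by regs
  | by [] ].

(** * Correctness and cost of the building blocks *)

Section Blocks.

Context {w n : nat} {adj : 'I_n -> seq 'I_n}.
Hypothesis word_size : n * n + n * n + 8 <= 2 ^ w.
Hypothesis size_adj : forall u, size (adj u) <= n.

Notation N := (n * n).
Notation wp := (@wp w n adj).

Implicit Types L H X : seq ('I_n * 'I_n).

Lemma w_gt0 : 0 < w.
Proof. by case: (w) word_size => //; rewrite expn0; lia. Qed.
Hint Resolve w_gt0 : core.

Lemma n_lt_word : n < 2 ^ w.
Proof. by have : n <= N; [case: (n) => // m; rewrite leq_pmulr | lia]. Qed.

Lemma wp_lookup r a d x Q :
  a != 1 -> d != 1 -> r != 1 ->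
  R x a < zsize x -> odflt (R x d) (Z x (R x a)) < 2 ^ w -> R x 12 = 1 ->
  (forall y, eff [:: 1; r] 4 (Z x) x y ->
     R y r = odflt (R x d) (Z x (R x a)) -> Q y) ->
  wp (lookup r a d) Q x.
Proof.
move=> a1 d1 r1 lt bound one HQ.
apply/wp_seq/wp_lwritten => // y E1 V1.
have Ra : R y a = R x a by rewrite (eff_reg E1) // inE.
have Rd : R y d = R x d by rewrite (eff_reg E1) // inE.
apply: wp_if => y' E2; rewrite V1 => S.
  case Zv : (Z x (R x a)) S bound HQ => [v|] //= _ bound HQ.
  apply: (wp_lload (v := v)) => //; try by regs.
  move=> y2 E3 V3 y3 E4; apply: HQ; first by chain.
  by rewrite (eff_reg E4).
case Zv : (Z x (R x a)) S bound HQ => [v|] //= _ bound HQ.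
apply: (wp_mul (v := R x d)) => //; first by regs; rewrite muln1.
by move=> y2 E3 V3; apply: HQ => //; chain.
Qed.

Lemma wp_move_to j i p L H x Q :
  13 <= j <= 14 -> R x 11 = N -> R x 12 = 1 -> zsize x = N + N ->
  zones (Z x) L H -> R x j = i -> i < N -> R x 7 = p -> p < N ->
  (forall y, eff [:: 1; 2; 3; 4; 5] 20 (moved n (Z x) i p) x y -> Q y) ->
  wp (move_to j) Q x.
Proof.
move=> jb N1 one sz zn Rj iN Rp pN HQ.
have [qN _] := zn_prm zn iN; have [iN' _] := zn_pos zn pN.
(* With a concrete register number all frame conditions are decided by computation. *)
have {jb} [Ej|Ej] : j = 13 \/ j = 14 by lia.
all: subst j.
all: apply/wp_seq/wp_lookup => //; try (by regs; lia);
  try (by rewrite Rj -/(prm (Z x) i); lia).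
all: rewrite Rj -/(prm (Z x) i) => y1 E1 V1.
all: apply/wp_seq/(wp_add (v := N + p)); [by regs | lia |] => y2 E2 V2.
all: apply/wp_seq/wp_lookup => //; regs; try lia;
  try (by rewrite -/(pos n (Z x) p); lia).
all: rewrite -/(pos n (Z x) p) => y3 E3 V3.
all: apply/wp_seq/wp_lstore; regs; [lia|] => y4 E4.
all: apply/wp_seq/(wp_add (v := N + prm (Z x) i)); [by regs|lia|] => y5 E5 V5.
all: apply/wp_seq/wp_lstore; regs; [lia|] => y6 E6.
all: apply/wp_seq/wp_lstore; regs; [lia|] => y7 E7.
all: apply/wp_lstore; regs; [lia|] => y8 E8.
all: by apply: HQ; chain.
Qed.

Lemma wp_push low p L H x Q :
  inv L H x -> R x 7 = code p -> p \notin L ++ H ->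
  (forall y z, inv (if low then rcons L p else L) (if low then H else p :: H) y ->
     eff [:: 1; 2; 3; 4; 5; 13; 14] 22 z x y -> Q y) ->
  wp (push low) Q x.
Proof.
move=> I Rp free HQ; have pN := code_lt p.
have [n1 N1 one lo hi sz mu zn] := I.
have := free; rewrite (zn_free p zn) => /andP[lb ub].
case: low HQ => HQ.
  apply/wp_seq/(wp_move_to (i := size L) (p := code p) (L := L) (H := H)) => //;
    try lia.
  move=> y1 E1; apply: (wp_add (v := (size L).+1)); [by regs; rewrite addn1|lia|].
  move=> y2 E2 V2; apply: (HQ _ (moved n (Z x) (size L) (code p))); last by chain.
  split; regs => //; first by rewrite size_rcons.
  - by rewrite (eff_mem E2) (eff_mem E1).
  - exact: zones_push_low.
apply/wp_seq/(wp_sub (v := (N - size H).-1)); [by regs; lia|by regs;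
  lia|] => y1 E1 V1.
apply: (wp_move_to (i := (N - size H).-1) (p := code p) (L := L) (H := H)) =>
  //; regs => //; try lia.
move=> y2 E2; apply: (HQ _ (moved n (Z x) (N - size H).-1 (code p)));
  last by chain.
split; regs => //; rewrite /=; first lia.
- by rewrite (eff_mem E2) (eff_mem E1).
- exact: zones_push_high.
Qed.

Definition low_zone (low : bool) L X := if low then L ++ X else L.
Definition high_zone (low : bool) H X := if low then H else X ++ H.

Lemma mem_zones low L H X p :
  (p \in low_zone low L X ++ high_zone low H X) = (p \in L ++ H) || (p \in X).
Proof.
rewrite /low_zone /high_zone; case: low; rewrite !mem_cat.
  by rewrite -orbA [(p \in X) || _]orbC orbA.
by rewrite [(p \in X) || _]orbC orbA.
Qed.

Lemma wp_push_if_free low p L H x Q :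
  inv L H x -> R x 7 = code p ->
  (forall y z, let X := if p \in L ++ H then [::] else [:: p] in
     inv (low_zone low L X) (high_zone low H X) y ->
     eff [:: 1; 2; 3; 4; 5; 13; 14] 40 z x y -> Q y) ->
  wp (push_if_free low) Q x.
Proof.
move=> I Rp HQ; have pN := code_lt p.
have [n1 N1 one lo hi sz mu zn] := I.
have [iN _] := zn_pos zn pN.
have free : (p \in L ++ H) = ~~ (size L <= pos n (Z x) (code p) < N - size H).
  by rewrite -(zn_free p zn) negbK.
apply/wp_seq/(wp_add (v := N + code p)); [by regs | lia |] => y1 E1 V1.
apply/wp_seq/wp_lookup => //; regs; try lia;
  try (by rewrite -/(pos n (Z x) (code p)); lia).
rewrite -/(pos n (Z x) (code p)) => y2 E2 V2.
apply/wp_seq/wp_lt => //; regs => y3 E3 V3.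
apply: wp_if => y4 E4; regs => S.
  have nf : p \in L ++ H by rewrite free; lia.
  rewrite nf /low_zone /high_zone /= in HQ.
  apply: wp_skip => y5 E5; apply: (HQ _ (Z x)); last by chain.
  have -> : (if low then L ++ [::] else L) = L by case: (low); rewrite ?cats0.
  have -> : (if low then H else H) = H by case: (low).
  keep I.
apply/wp_seq/wp_lt => //; regs => y5 E5 V5.
apply: wp_if => y6 E6; regs => S'; last first.
  have nf : p \in L ++ H by rewrite free; lia.
  rewrite nf /low_zone /high_zone /= in HQ.
  apply: wp_skip; apply: (HQ _ (Z x)); last by chain.
  have -> : (if low then L ++ [::] else L) = L by case: (low); rewrite ?cats0.
  have -> : (if low then H else H) = H by case: (low).
  keep I.
have nf : p \notin L ++ H by rewrite free; lia.
apply: (wp_push (p := p) (L := L) (H := H)) => //; first keep I.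
  by regs.
move=> y7 z I7 E7 y8 E8; apply: (HQ _ z); last by chain.
rewrite (negPf nf) /low_zone /high_zone /= cats1.
keep I7.
Qed.

(** [X] collects the newly found pairs. The two facts about [X] are the premises on new pairs and on
    completeness in the expansion lemmas of the search. *)
Lemma wp_push_nbrs low (u v : 'I_n) L H x Q :
  inv L H x -> R x 15 = u -> R x 16 = v ->
  (forall X y z,
     inv (low_zone low L X) (high_zone low H X) y ->
     (forall p, p \in X -> [/\ p \notin L ++ H, p.1 = u & p.2 \in adj v]) ->
     (forall a, a \in adj v -> (u, a) \in low_zone low L X ++ high_zone low H X)
       ->
     eff (iota 0 10 ++ [:: 13; 14]) (60 * size (adj v) + 10) z x y -> Q y) ->
  wp (push_nbrs low) Q x.
Proof.
move=> I Ru Rv HQ; have wn := n_lt_word; have dn := size_adj v.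
have [n1 N1 one lo hi sz mu zn] := I.
apply/wp_seq/wp_const; first lia; move=> y1 E1 V1.
apply/wp_seq/(wp_deg (u := v)); [by regs | lia |] => y2 E2 V2.
pose J i y := exists X z,
  [/\ inv (low_zone low L X) (high_zone low H X) y,
      forall p, p \in X -> [/\ p \notin L ++ H, p.1 = u & p.2 \in adj v],
      forall a, a \in take i (adj v) ->
        (u, a) \in low_zone low L X ++ high_zone low H X,
      eff (iota 0 10 ++ [:: 13; 14]) (60 * i + 5) z x y &
      [/\ R y 8 = i, R y 9 = size (adj v) & i <= size (adj v)]].
apply: (wp_while (I := J) (K := size (adj v)) (i := 0)) => //.
- exists [::], (Z x); split=> //; last by split=> //; regs.
    by rewrite /low_zone /high_zone cats0 !if_same; keep I.
  + by move=> a; rewrite take0.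
  + by chain.
- move=> i y [X [z [Iy XP Xall Ey [R8 R9 _]]]]; rewrite R8 R9 => lt;
  split=> // y3 E3.
  clear E1 E2 V1 V2.
  pose a := nth v (adj v) i.
  have [n1' N1' one' _ _ sz' _ zn'] := Iy.
  apply/wp_seq/(wp_adj (u := v) (v := a)); regs => //.
    by apply: set_nth_default.
  move=> y4 E4 V4; have ua := code_lt (u, a); rewrite /code /= in ua.
  apply/wp_seq/(wp_mul (v := u * n)); [by regs| lia|] => y5 E5 V5.
  apply/wp_seq/(wp_add (v := u * n + a)); [by regs| lia|] => y6 E6 V6.
  apply/wp_seq/(wp_push_if_free (p := (u, a)) (L := low_zone low L X)
    (H := high_zone low H X)).
  - keep Iy.
  - by regs.
  rewrite mem_zones => y7 z7 X1 I7 E7.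
  have [_ _ one7 _ _ _ _ _] := I7.
  apply: (wp_add (v := i.+1)); [by regs; rewrite addn1|lia|] => y8 E8 V8 y9 E9.
  (* The queue grows at its end, [H] at its front. *)
  pose X' := if low then X ++ X1 else X1 ++ X.
  have mX p : (p \in X') = (p \in X) || (p \in X1).
    by rewrite /X'; case: (low); rewrite mem_cat // orbC.
  have I9 : inv (low_zone low L X') (high_zone low H X') y9.
    have -> : low_zone low L X' = low_zone low (low_zone low L X) X1.
      by rewrite /X' /low_zone; case: (low); rewrite ?catA.
    have -> : high_zone low H X' = high_zone low (high_zone low H X) X1.
      by rewrite /X' /high_zone; case: (low); rewrite ?catA.
    keep I7.
  exists X', z7; split=> //.
  + move=> p; rewrite mX => /orP[/XP //|]; rewrite /X1.
    case: ifP => // /negbT; rewrite negb_or => /andP[nf _].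
    by rewrite inE => /eqP->; split=> //; apply: mem_nth.
  + move=> b; rewrite (take_nth v) // mem_rcons inE mem_zones mX.
    case/orP=> [/eqP->|/Xall]; last by rewrite mem_zones orbA => ->.
    rewrite -/a /X1; case: ifP; last by rewrite inE eqxx !orbT.
    by rewrite orbA => ->.
  + by chain.
  + by split=> //; regs => //.
- move=> i y y3 [X [z [Iy XP Xall Ey [R8 R9 lei]]]]; rewrite R8 R9 => ge E3.
  clear E1 E2 V1 V2.
  have ei : i = size (adj v) by lia.
  rewrite ei take_size in Xall.
  apply: (HQ X y3 z) => //; first keep Iy.
  by rewrite -ei; chain.
Qed.

End Blocks.

(** * The enumeration *)

(* Registers 17 and 18 hold the index and the bound of the inner loop, 20 the
   position h of the pair being expanded, 21 the number of initial pairs (u, u),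
   22 the current distance and 23 the end of the current level. *)

(** The first allocation returns address 0, so positions serve directly as addresses. The lower
    bound and the loop counters rely on registers being zero initially. *)
Definition setup :=
  Basic (INumV 10) ;; Basic (IConst 12 1) ;; Basic (IOp OpMul 11 10 10) ;;
  Basic (IOp OpAdd 0 11 11) ;; Basic (ILAlloc 0 0) ;;
  Basic (IOp OpMul 14 11 12).

(* The list of u has no duplicates, so some v != u is in it iff its length
   exceeds [its first element is u]. *)
Definition classify :=
  Basic (IDeg 9 15) ;; Basic (IConst 6 0) ;;
  If 9 (Basic (IAdj 6 15 6) ;; Basic (IOp OpEq 6 6 15) ;;
        Basic (IOp OpLt 6 6 9))
       Skip.

Definition preprocess :=
  setup ;;
  While 15 10
    (classify ;;
     Basic (IOp OpMul 7 15 10) ;; Basic (IOp OpAdd 7 7 15) ;;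
     If 6 (push true) (push false) ;;
     Basic (IOp OpAdd 15 15 12)) ;;
  Basic IReady.

Definition phase1 :=
  Basic (IOp OpMul 21 13 12) ;;
  While 20 21
    (lookup 7 20 20 ;; Basic (IOp OpDiv 15 7 10) ;;
     Basic (IOp OpMul 16 15 12) ;; push_nbrs false ;;
     Basic (IDeg 18 15) ;; Basic (IConst 17 0) ;;
     While 17 18
       (Basic (IAdj 16 15 17) ;; Basic (IOp OpEq 6 16 15) ;;
        If 6 Skip (Basic (IOutput 15 16 12) ;; push_nbrs true) ;;
        Basic (IOp OpAdd 17 17 12)) ;;
     Basic (IOp OpAdd 20 20 12)).

(** It starts at distance one with an empty level, so the first iteration immediately switches to
    distance two. The loop bound, register 13, grows while the queue is being filled. *)
Definition phase2 :=
  Basic (IConst 22 1) ;; Basic (IOp OpMul 23 20 12) ;;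
  While 20 13
    (Basic (IOp OpEq 6 20 23) ;;
     If 6 (Basic (IOp OpAdd 22 22 12) ;; Basic (IOp OpMul 23 13 12)) Skip ;;
     lookup 7 20 20 ;; Basic (IOp OpDiv 15 7 10) ;; Basic (IOp OpMod 16 7 10) ;;
     Basic (IOutput 15 16 22) ;; push_nbrs true ;;
     Basic (IOp OpAdd 20 20 12)).

Definition phase3 :=
  While 13 14
    (lookup 7 13 13 ;; Basic (IOp OpDiv 15 7 10) ;; Basic (IOp OpMod 16 7 10) ;;
     Basic (IOutputInf 15 16) ;; Basic (IOp OpAdd 13 13 12)).

Definition apsd := preprocess ;; phase1 ;; phase2 ;; phase3.

(** * Accounting for the time between events *)

Section Log.

Variables (C B : nat).

(** [C] bounds all gaps so far, [B] the time of the first event, and [a] the time elapsed since the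
    latest one: the part of the next gap already spent. *)
Definition log n (out : seq ('I_n * 'I_n * option nat)) a (x : cfg) : Prop :=
  [/\ unzip2 (trc x) = Ready ::
        [seq Output t.1.1 t.1.2 t.2 | t : 'I_n * 'I_n * option nat <- out],
      sorted (fun t t' => t' - t <= C) (unzip1 (trc x)),
      clk x <= last 0 (unzip1 (trc x)) + a &
      head 0 (unzip1 (trc x)) <= B].

Lemma log_eff n (out : seq ('I_n * 'I_n * option nat)) a b W k z x y :
  log out a x -> eff W k z x y -> a + k <= b -> log out b y.
Proof.
move=> [l1 l2 l3 l4] E ab; have ec := eff_clk E.
by rewrite /log (eff_trc E); split=> //; lia.
Qed.

Lemma log_emit n (out : seq ('I_n * 'I_n * option nat)) a (u v : 'I_n) d x y b :
  log out a x -> emit (Output u v d) x y -> a < C ->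
  log (rcons out (u, v, d)) b y.
Proof.
rewrite /log /unzip1 /unzip2 => -[l1 l2 l3 l4] E aC.
rewrite (em_trc E) (em_clk E) !map_rcons last_rcons.
split; last by case: (trc x) l1 l4.
- by rewrite l1.
- case: (trc x) l1 l2 l3 => [|[t ev] tr] //= _ l2 l3.
  by rewrite rcons_path l2 /=; rewrite /= in l3; lia.
- by rewrite /=; lia.
Qed.

End Log.

Ltac logs L := eapply (log_eff L);
  [ repeat first [ eassumption | eapply eff_trans; [eassumption |] ] | lia ].

Lemma nth_exists (T : Type) (s : seq T) i :
  i < size s -> exists x, forall x0, nth x0 s i = x.
Proof.
case: s => // y s lt; exists (nth y (y :: s) i) => x0.
by apply: set_nth_default.
Qed.

(** * Correctness and delay of the phases *)

Section Phases.

Variables (w n : nat) (e : rel 'I_n) (adj : 'I_n -> seq 'I_n).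
Hypothesis adj_e : adjacency_lists e adj.
Hypothesis word_size : n * n + n * n + 8 <= 2 ^ w.

Notation N := (n * n).
Notation wp := (@wp w n adj).
Notation D := (maxn 1 (max_degree e)).
Notation log := (@log (300 * D) (100 * maxn 1 n) n).
Notation triple := ('I_n * 'I_n * option nat)%type.

Implicit Types (L H E : seq ('I_n * 'I_n)) (S : seq 'I_n) (p : 'I_n * 'I_n).

Lemma mem_adj u v : (v \in adj u) = e u v.
Proof. by case: (adj_e u). Qed.

Lemma uniq_adj u : uniq (adj u).
Proof. by case: (adj_e u). Qed.

Lemma size_adj_D u : size (adj u) <= D.
Proof.
rewrite -(card_uniqP (uniq_adj u)) (eq_card (B := [pred v | e u v])); last first.
  by move=> v; rewrite mem_adj.
by rewrite leq_max; apply/orP; right; apply: leq_bigmax.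
Qed.

Lemma size_adj u : size (adj u) <= n.
Proof. by rewrite -(card_uniqP (uniq_adj u)) -[X in _ <= X]card_ord max_card. Qed.
Hint Resolve size_adj : core.

Let w0 : 0 < w := w_gt0 word_size.
Hint Resolve w0 : core.
Let n_lt : n < 2 ^ w := n_lt_word word_size.
Hint Resolve n_lt : core.

Definition diag S : seq ('I_n * 'I_n) := [seq (u, u) | u <- S].

Definition nontrivial u := has (fun v => v != u) (adj u).

Lemma mem_diag S p : (p \in diag S) = (p.1 == p.2) && (p.1 \in S).
Proof.
case: p => a b /=; apply/mapP/andP => [[u uS [-> ->]]|[/eqP <- aS]] //.
by exists a.
Qed.

Lemma wp_setup m (Q : cfg -> Prop) :
  (forall y, @inv n [::] [::] y -> R y 15 = 0 -> R y 20 = 0 -> clk y <= 6 ->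
     trc y = [::] -> Q y) ->
  wp setup Q (Cfg 0 (init m) [::]).
Proof.
move=> HQ.
apply/wp_seq/wp_numv => // y1 E1 V1.
apply/wp_seq/wp_const; first by lia.
move=> y2 E2 V2.
apply/wp_seq/(wp_mul (v := N)); [by regs | by lia|] => y3 E3 V3.
apply/wp_seq/(wp_add (v := N + N)); [by regs | by lia|] => y4 E4 V4.
apply/wp_seq/wp_alloc; [by regs=> /=; lia | by regs=> /=; lia|] => y5 E5 V5.
apply/(wp_mul (v := N)); first by regs; rewrite /=; regs; rewrite muln1.
  by lia.
move=> y6 E6 V6; apply: HQ.
- split; regs; rewrite /=; regs; rewrite /= ?subn0 //.
  + by rewrite (eff_mem E6) (eff_mem E5) /= (eff_mem E4) (eff_mem E3)
    (eff_mem E2) (eff_mem E1).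
  + exact: zones_init.
- by regs; rewrite /=; regs.
- by regs; rewrite /=; regs.
- have := eff_clk E1; have := eff_clk E2; have := eff_clk E3.
  by have := eff_clk E4; have := eff_clk E5; have := eff_clk E6; rewrite /=; lia.
- by regs; rewrite /=; regs.
Qed.

Lemma wp_classify (u : 'I_n) x (Q : cfg -> Prop) :
  R x 15 = u ->
  (forall y, eff [:: 6; 9] 8 (Z x) x y -> R y 6 = nontrivial u -> Q y) ->
  wp classify Q x.
Proof.
move=> Ru HQ; have dn := size_adj u.
apply/wp_seq/(wp_deg (u := u)) => //; first lia.
move=> y1 E1 V1; apply/wp_seq/wp_const; first lia.
move=> y2 E2 V2; have ua := uniq_adj u; rewrite /nontrivial in HQ.
apply: wp_if => y3 E3; regs; last first.
  move=> /size0nil nil; rewrite nil in HQ; apply: wp_skip.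
  by apply: HQ; [chain|regs].
case adjE: (adj u) HQ ua => [|v s] HQ //= /andP[vs us] _.
apply/wp_seq/(wp_adj (u := u) (v := v)); regs => //; rewrite ?adjE //.
move=> y4 E4 V4; apply/wp_seq/wp_eq => //; regs=> y5 E5 V5.
apply/wp_lt => //; regs=> y6 E6 V6 y7 E7.
apply: HQ; first by chain.
regs; rewrite adjE /=; congr nat_of_bool.
case: (eqVneq v u) => [vu|nvu] /=;
  last by rewrite (negPf (introN eqP _)) // => /val_inj /eqP; rewrite (negPf nvu).
rewrite vu eqxx /=; case: s vs {us adjE} => //= v' s.
by rewrite vu inE negb_or eq_sym => /andP[-> _].
Qed.

Lemma wp_preprocess m (Q : cfg -> Prop) :
  (forall S H y, inv (diag S) H y ->
     (forall u, (u \in S) = nontrivial u) ->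
     (forall p, (p \in diag S ++ H) = (p.1 == p.2)) ->
     R y 20 = 0 -> log [::] 0 y -> Q y) ->
  wp preprocess Q (Cfg 0 (init m) [::]).
Proof.
move=> HQ; apply/wp_seq/wp_setup => x I0 R15 R20 T0 trc0.
(* The diagonal pairs of the first [i] vertices have been sorted into queue and high zone. *)
pose J i y := exists S H z,
  [/\ inv (diag S) H y,
      forall u : 'I_n, (u \in S) = (u < i) && nontrivial u,
      forall p, (p \in diag S ++ H) = (p.1 == p.2) && (p.1 < i),
      eff (iota 0 10 ++ [:: 13; 14; 15]) (60 * i) z x y & R y 15 = i /\ i <= n].
apply/wp_seq/(wp_while (I := J) (K := n) (i := 0)) => //.
- exists [::], [::], (Z x); split=> //; last exact: eff_refl.
  by move=> p; rewrite ltn0 andbF.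
- move=> i y [S [H [z [Iy SP DP Ey [R15y _]]]]]; rewrite R15y (inv_n Iy) => lt;
  split=> // y1 E1.
  have [n' N' one' _ _ _ _ _] := Iy.
  pose u := Ordinal lt; have ui : i = u by [].
  apply/wp_seq/(wp_classify (u := u)); first by regs.
  move=> y2 E2 V2; have ucode := code_lt (u, u); rewrite /code /= in ucode.
  apply/wp_seq/(wp_mul (v := i * n)); [by regs | lia |] => y3 E3 V3.
  apply/wp_seq/(wp_add (v := i * n + i)); [by regs | lia |] => y4 E4 V4.
  have I4 : inv (diag S) H y4 by keep Iy.
  have free : (u, u) \notin diag S ++ H by rewrite DP /= ltnn andbF.
  pose t := nontrivial u.
  apply/wp_seq/(wp_mono (Q := fun y' => exists z',
    inv (if t then rcons (diag S) (u, u) else diag S)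
      (if t then H else (u, u) :: H) y' /\
    eff [:: 1; 2; 3; 4; 5; 13; 14] 24 z' y4 y')).
    move=> y5 [z5 [I5 E5]]; have [n5 _ one5 _ _ _ _ _] := I5.
    apply/(wp_add (v := i.+1)); [by regs; rewrite addn1|lia|] => y6 E6 V6 y7 E7.
    exists (if t then rcons S u else S), (if t then H else (u, u) :: H), z5.
    have Ed : diag (if t then rcons S u else S) = if t then rcons (diag S)
      (u, u) else diag S.
      by case: (t); rewrite /diag ?map_rcons.
    split.
    + by rewrite Ed; keep I5.
    + move=> a; rewrite ltnS leq_eqVlt andb_orl -SP.
      have -> : (a == i :> nat) = (a == u) by [].
      rewrite /t; case: ifP => tu; first by rewrite mem_rcons inE;
        case: eqP => //= ->; rewrite tu.
      by case: eqP => //= ->; rewrite tu SP tu andbF.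
    + move=> p; rewrite ltnS leq_eqVlt andb_orr -DP Ed.
      have -> : (p.1 == p.2) && (p.1 == i :> nat) = (p == (u, u)).
        case: p => a b; rewrite xpair_eqE /= -[_ == i]/(a == u).
        by case: (a =P u) => [->|]; rewrite ?andbF ?andbT //= eq_sym.
      case: (t); first by rewrite cat_rcons !mem_cat !inE orbCA.
      by rewrite !mem_cat !inE orbCA.
    + by chain.
    + by split; [regs|].
  have Rp : R y4 7 = code (u, u) by regs.
  apply: wp_if => y5 E5; regs; rewrite -/t.
    case: (t) => // _; apply: (wp_push word_size (p := (u, u)) (L := diag S)
      (H := H)) => //.
    + by keep I4.
    + by regs.
    move=> y6 z6 I6 E6 y7 E7; exists z6; split; first by keep I6.
    by chain.
  case: (t) => // _; apply: (wp_push word_size (p := (u, u)) (L := diag S)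
    (H := H)) => //.
  + by keep I4.
  + by regs.
  by move=> y6 z6 I6 E6; exists z6; split=> //; chain.
- move=> i y y1 [S [H [z [Iy SP DP Ey [R15y lei]]]]];
  rewrite R15y (inv_n Iy) => ge E1.
  have ein : i = n by lia.
  apply: (wp_emit (ev := Ready)) => // y2 E2.
  have Iy1 : inv (diag S) H y1 by keep Iy.
  apply: (HQ S H) => //.
  + exact: inv_emit Iy1 E2.
  + by move=> u; rewrite SP ein ltn_ord.
  + by move=> p; rewrite DP ein ltn_ord andbT.
  + by regs.
  (* At most 6 steps of setup and 60 per vertex, plus the last test and [IReady], fit into
     [100 * maxn 1 n]. *)
  + have := eff_clk E1; have := eff_clk Ey; have := em_clk E2;
    rewrite /log (em_trc E2); regs.
    by rewrite trc0 /= => *; split=> //; lia.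
Qed.

Definition one_hop (u : 'I_n) (s : seq 'I_n) : seq triple :=
  [seq (u, v, Some 1) | v <- s & v != u].

Definition near_out S : seq triple := flatten [seq one_hop u (adj u) | u <- S].

Lemma mem_near_out S p :
  (p \in [seq t.1 | t <- near_out S]) = [&& p.1 \in S, e p.1 p.2 & p.1 != p.2].
Proof.
case: p => a b /=; apply/mapP/and3P => [[[q d]]|[aS ab ne]].
  move=> /flatten_mapP[u uS /mapP[v]];
    rewrite mem_filter mem_adj => /andP[vu uv] [-> _] [-> ->].
  by rewrite eq_sym.
exists (a, b, Some 1) => //; apply/flatten_mapP; exists a => //.
by apply/mapP; exists b => //; rewrite mem_filter mem_adj eq_sym ne.
Qed.

(** Besides the frontier for distance two, the outcome records that the off-diagonal part of [H'] is
    exactly what has been output; this later separates these outputs from those of the queue. *)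
Lemma wp_phase1 S H x (Q : cfg -> Prop) :
  inv (diag S) H x -> (forall u, (u \in S) = nontrivial u) ->
  (forall p, (p \in diag S ++ H) = (p.1 == p.2)) ->
  R x 20 = 0 -> log [::] 0 x ->
  (forall E H' y, inv (diag S ++ E) H' y ->
     frontier e 1 (fun p => p \in (diag S ++ E) ++ H') xpred0 (fun p =>
       p \in E) ->
     (forall p, p.1 != p.2 ->
        (p \in H') = (p \in [seq t.1 | t <- near_out S])) ->
     R y 20 = size S -> log (near_out S) (140 * D) y -> Q y) ->
  wp phase1 Q x.
Proof.
move=> I0 SP DP R20 Log0 HQ.
have [n0 N0 one0 lo0 _ _ _ zn0] := I0.
have sS : size S <= N by have := zn_size zn0; rewrite size_map; lia.
have uS : uniq S.
  by have := zn_uniq zn0; rewrite map_inj_uniq // => a b [].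
apply/wp_seq/(wp_mul (v := size S)); [by regs;
  rewrite muln1 size_map | lia|] => x1 Ex1 Vx1.
(* Expanded so far: the non-loop edges out of the first [h] sources. *)
pose B h a b := [&& a \in take h S, e a b & a != b].
pose J h y := exists E H',
  [/\ inv (diag S ++ E) H' y,
      stage1 e (fun a => a \in take h S) (B h)
        (fun p => p \in (diag S ++ E) ++ H') (fun p => p \in E),
      [/\ R y 20 = h, R y 21 = size S & h <= size S] &
      log (near_out (take h S)) (130 * D) y].
apply: (wp_while (I := J) (K := size S) (i := 0)) => //.
- exists [::], H; rewrite cats0 take0; split=> //.
  + by keep I0.
  + by split=> // [p|a b c] /=; rewrite ?DP ?orbF // /B take0.
  + by split; regs.
  + by logs Log0.
- move=> h y [E [H' [Iy St [R20y R21y _] Logy]]]; rewrite R20y R21y => lt;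
  split=> // y1 E1.
  clear Ex1 Vx1; have [n' N' one' lo' _ sz' _ zn'] := Iy.
  have [u nu] := nth_exists lt.
  have hL : h < size (diag S ++ E) by rewrite size_cat size_map; lia.
  have prmh : prm (Z y) h = code (u, u).
    by rewrite (zn_get (u, u) zn' hL) nth_cat size_map lt (nth_map u) // nu.
  have uSin : u \in S by rewrite -(nu u) mem_nth.
  have takeS : take h.+1 S = rcons (take h S) u by rewrite (take_nth u) // nu.
  have cuu := code_lt (u, u); have ltu := ltn_ord u; have Du := size_adj_D u.
  have Nn := size_adj u.
  apply/wp_seq/(wp_lookup word_size) => //; try (by regs; lia); try (by regs;
    rewrite -/(prm (Z y) h) prmh; lia).
  move=> y2 E2; regs; rewrite -/(prm (Z y) h) prmh => V2.
  apply/wp_seq/(wp_div (v := u)); [by regs; rewrite code_div | lia |] => y3 E3 V3.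
  apply/wp_seq/(wp_mul (v := u)); [by regs; rewrite muln1 | lia |] => y4 E4 V4.
  apply/wp_seq/(wp_push_nbrs word_size size_adj (u := u) (v := u)
    (L := diag S ++ E) (H := H')).
  - by keep Iy.
  - by regs.
  - by regs.
  move=> X y5 z5 /= I5 XP Xall E5.
  apply/wp_seq/(wp_deg (u := u)); [by regs | lia |] => y6 E6 V6.
  apply/wp_seq/wp_const; first lia; move=> y7 E7 V7.
  pose B2 i a b := B h a b || [&& a == u, b \in take i (adj u) & a != b].
  (* Before the first output for u, the time spent on marking the neighbours of
     u is still to be accounted for. *)
  pose J2 i y := exists E H',
    [/\ inv (diag S ++ E) H' y,
        stage1 e (fun a => a \in take h.+1 S) (B2 i)
          (fun p => p \in (diag S ++ E) ++ H') (fun p => p \in E),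
        [/\ R y 15 = u, R y 18 = size (adj u), R y 20 = h & R y 21 = size S],
        R y 17 = i /\ i <= size (adj u) &
        log (near_out (take h S) ++ one_hop u (take i (adj u)))
          ((if has (fun v => v != u) (take i (adj u)) then 90 * D else 230 * D)
           + 20 * i) y].
  apply/wp_seq/(wp_while (I := J2) (K := size (adj u)) (i := 0)) => //.
  + exists E, (X ++ H'); split.
    * by keep I5.
    * apply: (stage1_sub (M := fun a => a \in take h.+1 S) (B := B h)) => //;
      last first.
        by move=> a b /orP[//|]; rewrite take0 in_nil andbF.
      apply: (stage1_mark (u := u) (X := fun p => p \in X) St).
      - by move=> a; rewrite takeS mem_rcons inE orbC.
      - by move=> p; rewrite !mem_cat; case: (p \in X); rewrite ?orbT ?orbF.
      - by move=> p /XP[_ -> ]; rewrite mem_adj.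
      - by move=> a ua; apply: Xall; rewrite mem_adj.
    * by split; regs.
    * by split; regs.
    * by rewrite take0 cats0 [has _ _]/=; logs Logy.
  + clear X y5 z5 I5 XP Xall E5 y6 E6 V6 y7 E7 V7 E1 E2 V2 E3 V3 E4 V4 y1 y2 y3
    y4.
    move=> i y1 [E1 [H1 [I1 St1 [R15 R18 R20' R21] [R17 _] Log1]]].
    rewrite R17 R18 => lti; split=> // y2 E2.
    have [n1 N1 one1 lo1 _ sz1 _ zn1] := I1.
    have [v nv] := nth_exists lti; have ltv := ltn_ord v; have Dv := size_adj_D v.
    have uv : e u v by rewrite -mem_adj -(nv v) mem_nth.
    have takeA : take i.+1 (adj u) = rcons (take i (adj u)) v by rewrite
      (take_nth v) // nv.
    apply/wp_seq/(wp_adj (u := u) (v := v)); regs => // y3 E3 V3.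
    apply/wp_seq/wp_eq => //; regs => y4 E4 V4.
    have E4' : R y4 6 = (v == u) by [].
    apply/wp_seq/(wp_mono (Q := fun y => exists E H',
      [/\ inv (diag S ++ E) H' y,
        stage1 e (fun a => a \in take h.+1 S) (B2 i.+1)
          (fun p => p \in (diag S ++ E) ++ H') (fun p => p \in E),
        [/\ R y 15 = u, R y 18 = size (adj u), R y 20 = h & R y 21 = size S],
        R y 17 = i &
        log (near_out (take h S) ++ one_hop u (take i.+1 (adj u)))
          ((if has (fun v => v != u) (take i.+1 (adj u)) then 90 * D else 230 * D)
           + 20 * i + 10) y])).
      clear y2 E2 y3 E3 V3 y4 E4 V4 E4'.
      move=> y2 [E2 [H2 [I2 St2 [R15' R18' R20'' R21'] R17' Log2]]].
      have [_ _ one2 _ _ _ _ _] := I2.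
      apply: (wp_add (v := i.+1)); [by regs;
        rewrite addn1|lia|] => y3 E3 V3 y4 E4.
      exists E2, H2; split=> //.
      * by keep I2.
      * by split; regs.
      * by split; regs.
      * by logs Log2.
    have Bstep a b : B2 i.+1 a b -> B2 i a b \/ (a = u /\ b = v).
      rewrite /B2 takeA mem_rcons inE =>
        /orP[->|/and3P[/eqP -> /orP[/eqP->|bi] ne]]; first by left.
        by right.
      by left; rewrite eqxx bi ne orbT.
    apply: wp_if => y5 E5; rewrite E4'.
    * case: (eqVneq v u) => // vu _; apply: wp_skip => y6 E6; exists E1, H1;
      split.
      - by keep I1.
      - apply: stage1_sub St1 _ _ => // a b /orP[|]; rewrite /B2;
        first by move=> ->.
        rewrite takeA mem_rcons inE => /and3P[/eqP -> /orP[/eqP->|bi] ne].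
          by rewrite vu eqxx in ne.
        by rewrite eqxx bi ne orbT.
      - by split; regs.
      - by regs.
      - rewrite takeA /one_hop filter_rcons has_rcons vu eqxx orFb.
        by case: ifP Log1 => _ Log1; logs Log1.
    * case: (eqVneq v u) => // vu _.
      apply/wp_seq/(wp_emit (ev := Output u v (Some 1))); first by rewrite /=;
        regs.
      move=> y6 E6.
      have I6 : inv (diag S ++ E1) H1 y6 by apply: inv_emit E6; keep I1.
      (* In the worse case this is the first output for [u]; even with the marking and up to [D]
         skipped self-loops it is in time. *)
      have Log5 : log (near_out (take h S) ++ one_hop u (take i (adj u)))
        (300 * D - 1) y5.
        by case: ifP Log1 => _ Log1; logs Log1.
      have Log6 := log_emit 0 Log5 E6.
      have [_ _ one6 _ _ _ _ _] := I6.
      apply: (wp_push_nbrs word_size size_adj (u := u) (v := v)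
        (L := diag S ++ E1) (H := H1) I6).
      - by regs.
      - by regs.
      move=> X y7 z7 /= I7 XP Xall E7; exists (E1 ++ X), H1; split.
      - by rewrite catA.
      - apply: (stage1_expand (u := u) (v := v) (X := fun p => p \in X) St1) =>
        //.
        + by rewrite takeS mem_rcons inE eqxx.
        + by move=> p; rewrite !mem_cat; case: (p \in X); rewrite ?orbT ?orbF.
        + by move=> p; rewrite mem_cat.
        + by move=> p /XP[]; rewrite mem_adj.
        + by move=> a va; rewrite catA; apply: Xall; rewrite mem_adj.
      - by split; regs.
      - by regs.
      - rewrite takeA /one_hop filter_rcons has_rcons vu /= map_rcons -rcons_cat.
        by apply: log_eff (Log6 _) E7 _; lia.
  + clear X y5 z5 I5 XP Xall E5 y6 E6 V6 y7 E7 V7 E1 E2 V2 E3 V3 E4 V4 y1 y2 y3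
    y4.
    move=> i y1 y2 [E1 [H1 [I1 St1 [R15 R18 R20' R21] [R17 lei] Log1]]].
    rewrite R17 R18 => ge E2; have ei : i = size (adj u) by lia.
    have [_ _ one1 _ _ _ _ _] := I1.
    apply: (wp_add (v := h.+1)); [by regs; rewrite addn1|lia|] => y3 E3 V3 y4 E4.
    rewrite ei take_size in St1 Log1; exists E1, H1; split.
    * by keep I1.
    * apply: stage1_sub St1 _ _ => // a b; rewrite /B2 /B takeS mem_rcons inE.
      move=> /and3P[/orP[/eqP->|ah] ab ne]; last by rewrite ah ab ne.
      by rewrite eqxx take_size mem_adj ab ne orbT.
    * by split; regs.
    * rewrite takeS /near_out map_rcons flatten_rcons.
      (* Every source in the queue has a proper neighbour, so there was an output for [u] and the
         marking time no longer counts towards the next gap. *)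
      have nt : has (fun v => v != u) (adj u) by rewrite -/(nontrivial u) -SP.
      by rewrite nt in Log1; logs Log1.
- move=> h y y1 [E [H' [Iy St [R20y R21y leh] Logy]]]; rewrite R20y R21y => ge E1.
  clear Ex1 Vx1; have eh : h = size S by lia.
  rewrite eh take_size in St Logy.
  (* A non-loop edge u -> v makes [u] nontrivial, hence a member of [S]; so all such edges have been
     expanded. *)
  have Fr : frontier e 1 (fun p => p \in (diag S ++ E) ++ H') xpred0 (fun p =>
    p \in E).
    apply: (stage1_end St) => u v uv ne;
      rewrite /B take_size uv ne !andbT andbb SP.
    by apply/hasP; exists v; rewrite ?mem_adj // eq_sym.
  apply: (HQ E H') => //.
  + by keep Iy.
  (* Off the diagonal, a visited pair outside [E] is a marked edge. A pair in [E] is at distance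
     two, thus no edge, and is not in [H'] as the zones are disjoint. *)
  + move=> p ne; rewrite mem_near_out ne andbT.
    have := s1_vis St p; rewrite !mem_cat mem_diag (negPf ne) /=.
    case pE : (p \in E) => /=; last by [].
    move=> _; case: (s1_next St pE) => /andP[_];
      rewrite near1 negb_or => /andP[_ /negPf ->].
    rewrite andbF; apply/negP => pH.
    by apply: (zn_disjoint (inv_zn Iy) _ pH); rewrite mem_cat pE orbT.
  + by regs.
  + by logs Logy.
Qed.

Definition dist_le (t t' : triple) : bool := le_dist t.2 t'.2.

(** The first [size S] queue entries are diagonal pairs and are never output themselves; behind the
    outputs of the first phase come the other entries before position [h], in queue order. *)
Record enumerated S L (out : seq triple) h : Prop := Enumerated {
  en_fst : [seq t.1 | t <- out] =
           [seq t.1 | t <- near_out S] ++ drop (size S) (take h L);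
  en_hop : forall t, t \in out ->
           t.1.1 != t.1.2 /\ hop_dist e t.1.1 t.1.2 t.2;
  en_sorted : sorted dist_le out }.

Lemma enumerated_near S L : enumerated S L (near_out S) (size S).
Proof.
have dist1 t : t \in near_out S -> t.2 = Some 1.
  by move=> /flatten_mapP[u _ /mapP[v _ ->]].
split.
- by rewrite drop_oversize ?cats0 // size_take_min geq_minl.
- move=> t tS; have := mem_near_out S t.1; rewrite (map_f (fun t => t.1) tS).
  move=> /esym /and3P[_ et ne]; split=> //; rewrite (dist1 _ tS).
  by apply: hop_dist_near; rewrite /= ?near1 ?et ?orbT //; apply/orP; right;
    apply/existsP; exists t.1.1; rewrite /= eqxx.
- elim: (near_out S) dist1 => // t [|t' s] IH //= dist1; apply/andP; split.
    by rewrite /dist_le !dist1 ?inE ?eqxx ?orbT.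
  by apply: IH => r rs; apply: dist1; rewrite inE rs orbT.
Qed.

(** The queue may change from [L] to [L'] provided the first [h] entries agree. This serves both the
    second phase, which outputs a pair and then appends, and the third, where the pair itself is
    appended. *)
Lemma enumerated_rcons S L L' (out : seq triple) h u v d :
  enumerated S L out h -> size S <= h -> h <= size L -> take h L' = take h L ->
  h < size L' -> nth (u, v) L' h = (u, v) ->
  u != v -> hop_dist e u v d -> all (fun t => le_dist t.2 d) out ->
  enumerated S L' (rcons out (u, v, d)) h.+1.
Proof.
move=> [ef eh es] Sh hL tL hL' nL ne hd le; split.
- rewrite map_rcons ef (take_nth (u, v)) // nL tL.
  by rewrite drop_rcons ?rcons_cat // size_take_min leq_min Sh (leq_trans Sh hL).
- by move=> t; rewrite mem_rcons inE => /orP[/eqP->|/eh].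
- case: out es le {ef eh} => // t out es le;
  rewrite /= rcons_path (es : path _ _ _).
  by apply: (allP le); apply: mem_last.
Qed.

Lemma le_dist_succ d (out : seq triple) :
  all (fun t => le_dist t.2 (Some d)) out ->
  all (fun t => le_dist t.2 (Some d.+1)) out.
Proof. by apply: sub_all => t; case: t.2 => //= a; apply: leqW. Qed.

Lemma wp_phase2 S E H x (Q : cfg -> Prop) :
  inv (diag S ++ E) H x ->
  frontier e 1 (fun p => p \in (diag S ++ E) ++ H) xpred0 (fun p => p \in E) ->
  R x 20 = size S -> log (near_out S) (140 * D) x ->
  (forall L out y, inv L H y -> take (size S) L = diag S -> size S <= size L ->
     (forall u v, (u, v) \notin L ++ H -> hop_dist e u v None) ->
     enumerated S L out (size L) -> log out (160 * D) y -> Q y) ->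
  wp phase2 Q x.
Proof.
move=> I0 Fr0 R20 Log0 HQ; have [n0 N0 one0 lo0 _ _ _ zn0] := I0.
have sS : size S <= N by have := zn_size zn0; rewrite size_cat size_map; lia.
apply/wp_seq/wp_const; first lia; move=> x1 Ex1 Vx1.
apply/wp_seq/(wp_mul (v := size S)); [by regs;
  rewrite muln1 | lia|] => x2 Ex2 Vx2.
(* Here [l] is the end of the level at distance [d]. The bound [d <= h.+1] keeps the distance within
   a word. *)
pose J h y := exists L d l out,
  [/\ inv L H y,
      frontier e d (fun p => p \in L ++ H) (fun p => p \in drop h (take l L))
        (fun p => p \in drop l L),
      [/\ size S <= h, h <= l, l <= size L, 0 < d & d <= h.+1],
      [/\ R y 20 = h, R y 22 = d & R y 23 = l] &
      [/\ take (size S) L = diag S, enumerated S L out h,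
          all (fun t => le_dist t.2 (Some d)) out & log out (150 * D) y]].
apply: (wp_while (I := J) (K := N) (i := size S)) => //.
- have sD : size (diag S) = size S by rewrite size_map.
  exists (diag S ++ E), 1, (size S), (near_out S); split.
  + by keep I0.
  + by apply: frontier_eq Fr0 _ _ _ => // p;
    rewrite -sD ?take_size_cat ?drop_size_cat // drop_size.
  + by split=> //; rewrite size_cat size_map leq_addr.
  + by split; regs.
  + split; first by rewrite -sD take_size_cat.
    * exact: enumerated_near.
    * by apply/allP => t /flatten_mapP[u _ /mapP[v _ ->]].
    * by logs Log0.
- move=> h y [L [d [l [out [Iy Fr [Sh hl lL d0 dh] [R20y R22y R23y] [tL En le
  Logy]]]]]].
  have [n1 N1 one1 lo1 _ sz1 _ zn1] := Iy.
  rewrite R20y lo1 => lt; have sN := zn_size zn1; split; first lia.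
  clear Ex1 Vx1 Ex2 Vx2 => y1 E1.
  apply/wp_seq/wp_eq => //; regs => y2 E2 V2.
  (* After a possible change of level the current level is nonempty; if it changed, the distance is
     one ahead, hence [d <= h.+2]. *)
  apply/wp_seq/(wp_mono (Q := fun y => exists d l,
    [/\ inv L H y,
      frontier e d (fun p => p \in L ++ H) (fun p => p \in drop h (take l L))
        (fun p => p \in drop l L),
      [/\ h < l, l <= size L, 0 < d & d <= h.+2],
      [/\ R y 20 = h, R y 22 = d & R y 23 = l] &
      all (fun t => le_dist t.2 (Some d)) out /\ log out (150 * D + 10) y])).
    clear d l Fr hl lL d0 dh R22y R23y le y1 E1 y2 E2 V2.
    move=> y1 [d [l [I1 Fr [hl lL d0 dh] [R20' R22 R23] [le Log1]]]].
    clear Logy R20y y n1 N1 one1 lo1 sz1 zn1 Iy.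
    have [n1 N1 one1 lo1 _ sz1 _ zn1] := I1.
    have [[u v] nuv] := nth_exists lt.
    have prmh : prm (Z y1) h = code (u, v) by rewrite (zn_get (u, v) zn1 lt) nuv.
    have cuv := code_lt (u, v); have ltu := ltn_ord u; have ltv := ltn_ord v.
    apply/wp_seq/(wp_lookup word_size) => //; try (by regs; lia); try (by regs;
      rewrite -/(prm (Z y1) h) prmh; lia).
    regs; rewrite -/(prm (Z y1) h) prmh => y2 E2 V2.
    apply/wp_seq/(wp_div (v := u)); [by regs;
      rewrite code_div | lia |] => y3 E3 V3.
    apply/wp_seq/(wp_mod (v := v)); [by regs;
      rewrite code_mod | lia |] => y4 E4 V4.
    have I4 : inv L H y4 by keep I1.
    apply/wp_seq/(wp_emit (ev := Output u v (Some d))); first by rewrite /=; regs.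
    move=> y5 E5; have I5 := inv_emit I4 E5.
    have Log4 : log out (300 * D - 1) y4 by logs Log1.
    have Log5 : log (rcons out (u, v, Some d)) 0 y5.
      by apply: log_emit Log4 E5 _; lia.
    have [_ _ one5 _ _ _ _ _] := I5; have Dv := size_adj_D v.
    apply/wp_seq/(wp_push_nbrs word_size size_adj (u := u) (v := v) I5);
      [by regs|by regs|].
    move=> X y6 z6 /= I6 XP Xall E6.
    have [_ _ one6 _ _ _ _ _] := I6.
    apply: (wp_add (v := h.+1)); [by regs; rewrite addn1|lia|] => y7 E7 V7 y8 E8.
    have Cuv : drop h (take l L) = (u, v) :: drop h.+1 (take l L).
      rewrite (drop_nth (u, v)); last by rewrite size_take_min leq_min hl lt.
      by rewrite nth_take // nuv.
    have tl : take l (L ++ X) = take l L by rewrite takel_cat.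
    have dl : drop l (L ++ X) = drop l L ++ X.
      rewrite drop_cat; case: ltnP => // ge; have -> : l = size L by lia.
      by rewrite subnn drop0 drop_size.
    (* The dequeued pair heads the current level, so its distance is exactly [d]. *)
    have [nd nd'] : near e d (u, v) /\ ~~ near e d.-1 (u, v).
      by apply/andP; apply: (fr_cur Fr); rewrite Cuv mem_head.
    exists (L ++ X), d, l, (rcons out (u, v, Some d)); split.
    + by keep I6.
    + apply: (frontier_expand (u := u) (v := v) (X := fun p => p \in X) Fr nd).
      * by move=> p; rewrite tl Cuv inE => /orP[/eqP|]; [left|right].
      * by move=> p; rewrite tl Cuv inE => ->; rewrite orbT.
      * by move=> p; rewrite !mem_cat; case: (p \in X); rewrite ?orbT ?orbF.
      * by move=> p; rewrite dl mem_cat.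
      * by move=> p /XP[]; rewrite mem_adj.
      * by move=> a va; apply: Xall; rewrite mem_adj.
    + by split=> //; rewrite ?size_cat; lia.
    + by split; regs.
    + split.
      * by rewrite takel_cat //; lia.
      * apply: (enumerated_rcons En) => //; try lia.
        - by rewrite takel_cat //; lia.
        - by rewrite size_cat; lia.
        - by rewrite nth_cat lt nuv.
        - by apply: contra nd' => uv; apply: (near_le (leq0n _)).
        - by case: (d) d0 nd nd' => // d' _; apply: hop_dist_near.
      * by rewrite all_rcons /= leqnn.
      * by logs Log5.
  apply: wp_if => y3 E3; regs; case: (eqVneq h l) => // hl' _.
  + apply/wp_seq/(wp_add (v := d.+1)); [by regs; rewrite addn1|lia|] => y4 E4 V4.
    apply/(wp_mul (v := size L)); [by regs; rewrite muln1|lia|] => y5 E5 V5 y6 E6.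
    exists d.+1, (size L); split.
    * by keep Iy.
    * have C0 : (fun p => p \in drop h (take l L)) =1 xpred0.
        by move=> p; rewrite hl' drop_oversize // size_take_min geq_minl.
      apply: frontier_eq (frontier_level Fr C0) _ _ _ => // p.
        by rewrite take_size hl'.
      by rewrite drop_size.
    * by split=> //; lia.
    * by split; regs.
    * by split; [apply: le_dist_succ | logs Logy].
  + apply: wp_skip; exists d, l; split=> //.
    * by keep Iy.
    * by split=> //; lia.
    * by split; regs.
    * by split; [|logs Logy].
- move=> h y y1 [L [d [l [out [Iy Fr [Sh hl lL d0 dh] [R20y R22y R23y] [tL En le
  Logy]]]]]].
  clear Ex1 Vx1 Ex2 Vx2; rewrite R20y (inv_lo Iy) => ge E1.
  (* The queue is exhausted, so both the current and the next level are empty and the search is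
     complete. *)
  have [eh el] : h = size L /\ l = size L by lia.
  apply: (HQ L out y1) => //.
  + by keep Iy.
  + by lia.
  + move=> u v nf; apply: (frontier_end Fr) => // p.
      by rewrite el take_size drop_oversize //; lia.
    by rewrite drop_oversize //; lia.
  + by rewrite -eh.
  + by logs Logy.
Qed.

(** Every pair left in the middle zone is unreachable, so each iteration outputs one in constant
    time, until the low zone meets the high zone. *)
Lemma wp_phase3 S L H out x (Q : cfg -> Prop) :
  inv L H x -> take (size S) L = diag S -> size S <= size L ->
  (forall u v, (u, v) \notin L ++ H -> hop_dist e u v None) ->
  enumerated S L out (size L) -> log out (160 * D) x ->
  (forall L out y, inv L H y -> take (size S) L = diag S ->
     size L + size H = N -> enumerated S L out (size L) ->
     log out (170 * D) y -> Q y) ->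
  wp phase3 Q x.
Proof.
move=> I0 tL0 SL0 far0 En0 Log0 HQ.
pose J i y := exists L out,
  [/\ inv L H y, take (size S) L = diag S /\ size S <= size L,
      forall u v, (u, v) \notin L ++ H -> hop_dist e u v None,
      enumerated S L out (size L) &
      log out (160 * D) y /\ i = size L].
apply: (wp_while (I := J) (K := N) (i := size L)) => //; first by exists L, out.
- clear L out x I0 tL0 SL0 far0 En0 Log0.
  move=> i y [L [out [Iy [tL SL] far En [Logy ->]]]].
  have [n1 N1 one1 lo1 hi1 sz1 _ zn1] := Iy.
  rewrite lo1 hi1 => lt; split=> [|y1 E1]; first lia.
  have sN := zn_size zn1.
  have [|[u v] [prmh nf zn2]] := zones_free zn1; first lia.
  have cuv := code_lt (u, v); have ltu := ltn_ord u; have ltv := ltn_ord v.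
  apply/wp_seq/(wp_lookup word_size) => //; try (by regs; lia); try (by regs;
    rewrite -/(prm (Z y) (size L)) prmh; lia).
  regs; rewrite -/(prm (Z y) (size L)) prmh => y2 E2 V2.
  apply/wp_seq/(wp_div (v := u)); [by regs; rewrite code_div | lia |] => y3 E3 V3.
  apply/wp_seq/(wp_mod (v := v)); [by regs; rewrite code_mod | lia |] => y4 E4 V4.
  have I4 : inv L H y4 by keep Iy.
  apply/wp_seq/(wp_emit (ev := Output u v None)); first by rewrite /=; regs.
  move=> y5 E5; have I5 := inv_emit I4 E5.
  have Log4 : log out (300 * D - 1) y4 by logs Logy.
  have Log5 : log (rcons out (u, v, None)) 0 y5.
    by apply: log_emit Log4 E5 _; lia.
  have [n5 N5 one5 lo5 hi5 sz5 mu5 _] := I5.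
  apply: (wp_add (v := (size L).+1)); [by regs;
    rewrite addn1|lia|] => y6 E6 V6 y7 E7.
  exists (rcons L (u, v)), (rcons out (u, v, None)); split.
  + split; regs => //; first by rewrite size_rcons.
    by rewrite (eff_mem E7) (eff_mem E6).
  + by rewrite size_rcons -cats1 takel_cat //; split=> //; apply: leqW.
  + move=> a b; rewrite -cats1 => nab; apply: far; apply: contra nab.
    by rewrite !mem_cat => /orP[->|->]; rewrite ?orbT.
  + rewrite size_rcons; apply: (enumerated_rcons En) => //.
    * by rewrite -cats1 takel_cat.
    * by rewrite size_rcons.
    * by rewrite nth_rcons ltnn eqxx.
    (* The empty walk rules out an unreachable diagonal pair. *)
    * apply/eqP => uv; have := far _ _ nf [::].
      by rewrite uv /walk /= eqxx.
    * exact: far.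
    * by apply/allP => t _; case: (t.2).
  + by split; [logs Log5 | rewrite size_rcons].
- clear L out x I0 tL0 SL0 far0 En0 Log0.
  move=> i y y1 [L [out [Iy [tL SL] far En [Logy _]]]].
  have [_ _ _ lo1 hi1 _ _ zn1] := Iy; rewrite lo1 hi1 => ge E1.
  apply: (HQ L out) => //; first by keep Iy.
    by have := zn_size zn1; lia.
  by logs Logy.
Qed.

Lemma zones_full z L H p : zones z L H -> size L + size H = N -> p \in L ++ H.
Proof.
move=> zn full; apply/negbNE/negP; rewrite (zn_free p zn); lia.
Qed.

Lemma uniq_near_out S : uniq S -> uniq [seq t.1 | t <- near_out S].
Proof.
elim: S => //= u S IH /andP[uS unS]; rewrite map_cat cat_uniq IH // andbT.
apply/andP; split.
  by rewrite -map_comp map_inj_uniq ?filter_uniq ?uniq_adj // => a b [].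
apply/hasPn => p; rewrite mem_near_out => /and3P[pS _ _].
apply/mapP => -[t /mapP[v _ ->] /= pu]; by rewrite pu /= (negPf uS) in pS.
Qed.

(** The zones split all pairs into [L] and [H]. Off the diagonal, [H] is the output of the first
    phase and the rest of the queue that of the later ones; disjointness excludes repetitions and
    fullness excludes omissions. *)
Lemma enumerated_APSD S L H out x :
  inv L H x -> take (size S) L = diag S -> size L + size H = N ->
  (forall p, p.1 != p.2 -> (p \in H) = (p \in [seq t.1 | t <- near_out S])) ->
  enumerated S L out (size L) -> sorted_no_self_APSD e out.
Proof.
move=> I tL full HP [ef eh es]; have zn := inv_zn I; rewrite take_size in ef.
have uL := zn_uniq zn.
have uS : uniq S.
  have : uniq (diag S) by rewrite -tL take_uniq.
  by rewrite map_inj_uniq // => a b [].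
split=> //.
- apply: (@map_uniq _ _ (fun t => t.1));
  rewrite ef cat_uniq uniq_near_out // drop_uniq // andbT.
  apply/hasPn => p /mem_drop pL; apply/negP => pS.
  have ne : p.1 != p.2 by move: pS; rewrite mem_near_out => /and3P[].
  by apply: (zn_disjoint zn pL); rewrite HP.
- move=> u v d; split=> [/eh /= [/eqP ne hd] //|[/eqP ne hd]].
  have : (u, v) \in [seq t.1 | t <- out].
    rewrite ef mem_cat -HP //; have := zones_full (u, v) zn full.
    rewrite mem_cat -{1}(cat_take_drop (size S) L) mem_cat tL mem_diag /= (negPf
      ne) /=.
    by rewrite orbC.
  case/mapP=> -[[a b] d'] tin [/= ua vb]; subst a b.
  by have [_ hd'] := eh _ tin; rewrite (hop_dist_uniq hd hd').
Qed.

Lemma wp_apsd m :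
  wp apsd (fun y => exists out L H,
     [/\ @inv n L H y, sorted_no_self_APSD e out & log out (170 * D) y])
  (Cfg 0 (init m) [::]).
Proof.
apply/wp_seq/wp_preprocess => S H0 y0 I0 SP DP R20 Log0.
apply/wp_seq/(wp_phase1 I0 SP DP R20 Log0) => E H y1 I1 Fr HP R20' Log1.
apply/wp_seq/(wp_phase2 I1 Fr R20' Log1) => L1 out1 y2 I2 tL SL far En2 Log2.
apply: (wp_phase3 I2 tL SL far En2 Log2) => L out y3 I3 tL3 full En3 Log3.
by exists out, L, H; split=> //; apply: enumerated_APSD I3 tL3 full HP En3.
Qed.

End Phases.

Theorem theorem18 :
  exists (P : program) (k c : nat),
  forall (n w : nat) (e : rel 'I_n) (adj : 'I_n -> seq 'I_n)
         (mem0 : nat -> nat),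
    adjacency_lists e adj ->
    k * (trunc_log 2 n).+1 <= w ->
    (forall a, mem0 a < 2 ^ w) ->
  exists (tr : seq (nat * event)) (out : seq ('I_n * 'I_n * option nat))
         (sf : state),
    run w adj P 0 (init mem0) tr sf /\
    trace_of tr out /\
    sorted_no_self_APSD e out /\
    preprocessing_in_O c n tr /\
    delay_in_O c (max_degree e) tr /\
    in_Theta c (lazy_size sf) (n ^ 2) /\
    in_Theta c (space sf) (n ^ 2).
Proof.
(* With t the bit length used below, n < 2^t and t >= 1, so 2n^2 + 8 <= 2^(2t + 4) <= 2^(6t), whence
   6. The 300 is the delay constant; it dominates the 100 of preprocessing and the 2 of space. *)
exists (comp 0 apsd ++ [:: IHalt]), 6, 300 => n w e adj m adj_e kw _.
have word_size : n * n + n * n + 8 <= 2 ^ w.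
  pose t := (trunc_log 2 n).+1.
  have nt : n < 2 ^ t by apply: trunc_log_ltn.
  have tw : 2 ^ t * 2 ^ t * 2 ^ 4 <= 2 ^ w.
    by rewrite -!expnD leq_exp2l //; rewrite /t in kw *; lia.
  have : n * n <= 2 ^ t * 2 ^ t by apply: leq_mul; apply: ltnW.
  have : 1 <= 2 ^ t * 2 ^ t by rewrite muln_gt0 expn_gt0.
  rewrite (_ : 2 ^ 4 = 16) // in tw.
  lia.
have codeP : code_at (comp 0 apsd ++ [:: IHalt]) 0 (comp 0 apsd) by exists [::],
  [:: IHalt].
have [y [xy py [out [L [H [I sorted_out [l1 l2 l3 l4]]]]]]] :=
  wp_apsd adj_e word_size (m := m) codeP erefl.
(* The final [IHalt] starts the backward composition: [leads] turns this one-step run into a run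
   from the initial state. *)
have halts : @completes w n adj (comp 0 apsd ++ [:: IHalt]) y
               (rcons (trc y) ((clk y).+1, Halted)) (st y).
  exists [:: ((clk y).+1, Halted)]; first by rewrite cats1.
  by apply: run_halt; rewrite py add0n -(size_comp apsd 0) onth_cat ltnn subnn.
have [tr /= <- ru] := xy _ _ halts.
exists (rcons (trc y) ((clk y).+1, Halted)), out, (st y); split=> //.
have zs := inv_size I; have mu := inv_mem I.
have [t [ev [tl]]] : exists t ev tl, trc y = (t, ev) :: tl.
  by case: (trc y) l1 => // -[t ev] tl _; exists t, ev, tl.
rewrite /trace_of /preprocessing_in_O /delay_in_O /in_Theta /in_O /space zs mu
  add0n.
rewrite /unzip1 /unzip2 in l1 l2 l3 l4 *; rewrite !map_rcons l1 -mulnn /=.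
move=> trE; rewrite trE /= in l2 l3 l4 *; rewrite rcons_path l2 /=.
by do ![split=> //]; lia.
Qed.
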